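(* Let $0<\alpha<2$ and let $X(t)$, $t\in T$ ($T\ne\emptyset$), be a separable symmetric $\alpha$-stable process. Let $\rho(s,t)$ be the scale parameter of $X(t)-X(s)$, i.e. $\mathbb{E}\exp\{iu(X(t)-X(s))\}=\exp\{-\rho(t,s)^\alpha|u|^\alpha\}$, assume $\sigma=\operatorname{diam}(T,\rho)<\infty$ and $(T,\rho)$ is relatively compact, and let $N(\varepsilon)$ be the covering numbers of $(T,\rho)$. Assume $N(\varepsilon)\le\Psi(\varepsilon)$ for all $\varepsilon>0$, where $\Psi$ is a non-increasing continuous function with $$\Psi(\varepsilon/2)\le C_2\Psi(\varepsilon)\qquad\text{for all }\varepsilon>0,$$ for some constant $1<C_2<2^\alpha$. Define $\widetilde\Psi(\varepsilon)=\int_\varepsilon^\sigma\frac{\Psi(u)}{u}\,du$ for $0<\varepsilon\le\sigma/2$ and $\widetilde\Psi(\varepsilon)=\Psi(\varepsilon)$ for $\varepsilon\ge\sigma/2$. Then $$\log\mathbb{P}\Big(\sup_{s,t\in T}|X(s)-X(t)|\le K_0\varepsilon\Big)\ge -K\,\widetilde\Psi(\varepsilon)\qquad\text{for all }\varepsilon>0,$$ with a universal constant $K_0>0$ and a constant $K>0$ depending only on $\alpha$ and $C_2$.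
   Context: A process is symmetric $\alpha$-stable if all its finite-dimensional distributions are symmetric $\alpha$-stable vectors. The covering number $N(\varepsilon)$ is the minimal number of points $t_1,\dots,t_n\in T$ such that every $t\in T$ has $\rho(t,t_i)\le\varepsilon$ for some $i$. *)

(* Defs.v *)
From HB Require Import structures.
From mathcomp Require Import all_boot all_order all_algebra.
From mathcomp Require Import all_classical all_reals all_analysis.
Set Implicit Arguments. Unset Strict Implicit. Unset Printing Implicit Defensive.
Import Order.TTheory GRing.Theory Num.Theory.
Import numFieldNormedType.Exports.
Local Open Scope classical_set_scope.
Local Open Scope ring_scope.

Section sas.
Context {R : realType} {d : measure_display} {Omega : measurableType d}.
Variable P : probability Omega R.

Definition unit_sphere (n : nat) : set (n.-tuple R) :=
  [set s | \sum_(i < n) (tnth s i) ^+ 2 = 1].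

(* A random vector Y = (Y_1,...,Y_n) is symmetric alpha-stable if there is a
   finite symmetric measure Gamma on the unit sphere (the spectral measure)
   such that  E exp(i <theta, Y>) = exp(- \int |<theta, s>|^alpha Gamma(ds))
   for all theta in R^n.  E exp(i Z) is written through its real part
   E cos Z and imaginary part E sin Z. *)
Definition SaS_vector (alpha : R) (n : nat) (Y : 'I_n -> Omega -> R) : Prop :=
  exists Gamma : {finite_measure set (n.-tuple R) -> \bar R},
    [/\ Gamma (~` unit_sphere (n:=n)) = 0%E,
        (forall A : set (n.-tuple R), measurable A ->
           Gamma [set s | A (map_tuple (fun x => - x) s)] = Gamma A) &
        forall theta : n.-tuple R,
          ('E_P[fun w => cos (\sum_(i < n) tnth theta i * Y i w)]
             = (expR (- Rintegral Gamma setT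
                   (fun s => `|\sum_(i < n) tnth theta i * tnth s i| `^ alpha)))%:E)%E
          /\ ('E_P[fun w => sin (\sum_(i < n) tnth theta i * Y i w)] = 0)%E].

Definition SaS_process (alpha : R) (T : Type) (X : T -> {RV P >-> R}) : Prop :=
  forall (n : nat) (t : 'I_n -> T), SaS_vector alpha (fun i => X (t i)).

Definition separable_process (T : Type) (rho : T -> T -> R)
    (X : T -> {RV P >-> R}) : Prop :=
  exists (S : set T) (N : set Omega),
    [/\ countable S, measurable N, P N = 0%E &
        forall w, ~ N w -> forall (t : T) (e : R), 0 < e ->
          exists2 s, S s & rho s t < e /\ `|X s w - X t w| < e].

End sas.

Section metric_notions.
Context {R : realType} {T : Type}.
Variable rho : T -> T -> R.

Definition diam : R := sup [set x | exists s t, x = rho s t].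

Definition diam_finite : Prop := has_ubound [set x | exists s t, x = rho s t].

(* (T, rho) is totally bounded (= relatively compact in the completion). *)
Definition totally_bounded : Prop :=
  forall e : R, 0 < e -> exists (n : nat) (f : 'I_n -> T),
    forall t, exists i, rho t (f i) <= e.

Definition covering_number (e : R) : \bar R :=
  ereal_inf [set (n%:R)%:E | n in
    [set n : nat | exists f : 'I_n -> T, forall t, exists i, rho t (f i) <= e]].
End metric_notions.

Definition Psi_tilde {R : realType} (Psi : R -> R) (sigma e : R) : R :=
  if (0 < e) && (e <= sigma / 2) then
    Rintegral (@lebesgue_measure R) `[e, sigma] (fun u => Psi u / u)
  else Psi e.

(* Main.v *)
Require Import Defs.
From HB Require Import structures.
From mathcomp Require Import all_boot all_order all_algebra.
From mathcomp Require Import all_classical all_reals all_analysis.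
From mathcomp Require Import measurable_realfun ring lra zify.
Import Order.TTheory GRing.Theory Num.Theory.
Import numFieldNormedType.Exports.
Local Open Scope classical_set_scope.
Local Open Scope ring_scope.

(* Chaining, with a correlation inequality replacing Sidak's lemma.  Let [Q] be
   the characteristic exponent of a symmetric alpha-stable vector.  Clarkson's
   inequality |a+b|^alpha + |a-b|^alpha <= 2|a|^alpha + 2|b|^alpha gives
   Q(x+y) + Q(x-y) <= 2 Q(x) + 2 Q(y); hence, by AM-GM, two cosine sums f, g with
   nonnegative coefficients satisfy E[f g] >= E[f] E[g].  Applied to cosine sums
   approximating Bohman's compactly supported positive definite function, this
   yields P(|xi_i| <= a_i for all i) >= prod_i exp(- cost(rho_i / a_i)), where
   rho_i is the scale of xi_i and cost(r) is of order min(r^alpha, 1 + log^+ r).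

   At scales below eps the increments of the level eps 2^-k get the tolerance
   (1-q) q^k eps; the total cost is a geometric series times Psi(eps) because
   C2 < (2q)^alpha.  At scales above eps, decreasing subsets of one eps-net are
   used and a point is linked only at the level j where it is dropped, at a cost
   of order 1 + j; Abel summation turns this into sum_j Psi(eps 2^j), which is
   the integral defining Psi_tilde up to a constant.  The quasi-triangle inequality
   rho(s,u)^alpha <= 2 rho(s,t)^alpha + 2 rho(t,u)^alpha makes this work for
   alpha < 1 too. *)

(** * Elementary inequalities *)

Lemma abs_sub_le_of_deriv {R : realType} (f df : R -> R) :
  (forall x : R, is_derive x 1 f (df x)) -> (forall x, `|df x| <= 1) ->
  forall a b, `|f a - f b| <= `|a - b|.
Proof.
move=> fdf df1 a b.
wlog ba : a b / b <= a.
  move=> wl; have [|/ltW ab] := leP b a; first exact: wl.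
  by rewrite distrC (distrC a); exact: wl.
have [|c _ ->] := @MVT_segment R f df b a ba (fun x _ => fdf x).
  apply: derivable_within_continuous => x _.
  exact: (@ex_derive _ _ _ _ _ _ _ (fdf x)).
by rewrite normrM ler_piMl.
Qed.

Lemma abs_sin_le {R : realType} (x : R) : `|sin x| <= `|x|.
Proof.
have := @abs_sub_le_of_deriv R sin cos (@is_derive_sin R) (@cos_max R) x 0.
by rewrite sin0 !subr0.
Qed.

Lemma abs_cos_sub_le {R : realType} (x y : R) : `|cos x - cos y| <= `|x - y|.
Proof.
apply: (@abs_sub_le_of_deriv R cos (fun x => - sin x)) => z.
by rewrite normrN sin_max.
Qed.

Lemma one_sub_cosE {R : realType} (x : R) : 1 - cos x = 2 * sin (x / 2) ^+ 2.
Proof.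
have {1}-> : x = (x / 2) *+ 2 by rewrite -mulr_natr divfK.
by rewrite cos_mulr2n; have := cos2Dsin2 (x / 2); lra.
Qed.

Lemma one_sub_cos_le {R : realType} (x : R) : 1 - cos x <= x ^+ 2 / 2.
Proof.
rewrite one_sub_cosE.
have : sin (x / 2) ^+ 2 <= (x / 2) ^+ 2.
  by rewrite -real_normK ?num_real// -[leRHS]real_normK ?num_real// lerXn2r ?nnegrE// abs_sin_le.
by rewrite expr_div_n; lra.
Qed.

Lemma mul_cos_le_sin {R : realType} (t : R) : 0 <= t <= pi / 2 -> t * cos t <= sin t.
Proof.
move=> /andP[t0 tpi].
have cD (x : R) : is_derive x 1 (fun x => sin x - x * cos x) (x * sin x).
  apply: is_derive_eq; rewrite /GRing.scale /=; ring.
have [|c /itvP cI] := @MVT_segment R _ (fun x => x * sin x) 0 t t0 (fun x _ => cD x).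
  apply: derivable_within_continuous => x _.
  exact: (@ex_derive _ _ _ _ _ _ _ (cD x)).
rewrite sin0 mul0r !subr0 => h.
have : 0 <= c * sin c * t.
  rewrite mulr_ge0// mulr_ge0 ?cI// sin_ge0_pi// cI/=.
  have : c <= t by rewrite cI.
  by have := pi_gt0 R; lra.
by rewrite -h; lra.
Qed.

Lemma one_sub_cos_ge {R : realType} (w : R) : 0 <= w <= pi -> w ^+ 2 / 8 <= 1 - cos w.
Proof.
move=> /andP[w0 wpi].
(* Since [t] is at most pi/4, (cos t)^2 >= 1/2, so sin (w/2) = 2 sin t cos t >= 2 t (cos t)^2 >=
   t. *)
set t := w / 4.
have t0 : 0 <= t by rewrite /t; lra.
have tpi : t <= pi / 4 by rewrite /t; lra.
have pi0 := pi_gt0 R.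
have h1 : t * cos t <= sin t by apply: mul_cos_le_sin; apply/andP; split; lra.
have h2 : 1 / 2 <= cos t ^+ 2.
  have : 0 <= cos (t *+ 2).
    by apply: cos_ge0_pihalf; rewrite -mulr_natr; apply/andP; split; lra.
  rewrite cos_mulr2n -mulr_natr; lra.
have h3 : 0 <= cos t by apply: cos_ge0_pihalf; apply/andP; split; lra.
have h4 : t <= sin (w / 2).
  have -> : w / 2 = t *+ 2 by rewrite /t -mulr_natr; lra.
  rewrite sin_mulr2n -mulr_natr.
  nra.
rewrite one_sub_cosE.
have -> : w = 4 * t by rewrite /t; lra.
move: h4; have -> : w / 2 = 4 * t / 2 by rewrite /t; lra.
nra.
Qed.

(** * Finite Fourier analysis of the sine window *)

(** Telescoping: 2 sin (t/2) cos (k t) = sin (k t + t/2) - sin (k t - t/2). *)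
Lemma sum_cos_mul {R : realType} (t : R) (M : nat) :
  2 * sin (t / 2) * (\sum_(k < M) cos (k%:R * t)) =
  sin (M%:R * t - t / 2) + sin (t / 2).
Proof.
elim: M => [|M IH]; first by rewrite big_ord0 mulr0 mul0r add0r sinN addNr.
rewrite big_ord_recr/= mulrDr IH.
have -> : M.+1%:R * t - t / 2 = M%:R * t + t / 2 by rewrite -natr1; lra.
rewrite sinB sinD; ring.
Qed.

(** Orthogonality of the characters of Z/M, the hypotheses saying |a - b| < M. For a > b and t = 2
    pi (a - b) / M, M t is a whole number of turns, so the right-hand side of [sum_cos_mul] cancels
    while sin (t/2) > 0. *)
Lemma sum_cos_root_of_unity {R : realType} (a b M : nat) :
  (a < b + M)%N -> (b < a + M)%N ->
  \sum_(k < M) cos ((a%:R - b%:R) * (2 * pi * k%:R / M%:R)) =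
  (if a == b then M%:R else 0) :> R.
Proof.
wlog ba : a b / (b <= a)%N.
  move=> wl h1 h2; have [|/ltnW ab] := leqP b a => [ba|]; first exact: wl.
  rewrite eq_sym -wl//; apply: eq_bigr => k _.
  by rewrite -cosN -mulNr opprB.
move=> h1 h2; rewrite -natrB//; case: eqVneq => [->|ab].
  under eq_bigr do rewrite subnn mul0r cos0.
  by rewrite sumr_const card_ord.
have M0 : 0 < M%:R :> R by rewrite ltr0n; lia.
have d0 : 0 < (a - b)%:R :> R by rewrite ltr0n; move/eqP: ab; lia.
have dM : (a - b)%:R < M%:R :> R by rewrite ltr_nat; lia.
set d := (a - b)%N in d0 dM *.
have pi0 := pi_gt0 R.
set t : R := 2 * pi * d%:R / M%:R.
have t2 : t / 2 = pi * (d%:R / M%:R) by rewrite /t; field; rewrite gt_eqF.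
have st : 0 < sin (t / 2).
  apply: sin_gt0_pi; rewrite t2 mulr_gt0 ?divr_gt0//=.
  by rewrite gtr_pMr// ltr_pdivrMr// mul1r.
have := sum_cos_mul t M.
have -> : M%:R * t - t / 2 = - (t / 2) + (pi *+ 2) *+ d.
  by rewrite /t -(mulr_natr _ d) -(mulr_natr pi 2); field; rewrite gt_eqF.
rewrite (periodicn (@sinD2pi R)) sinN addNr => /eqP.
rewrite mulf_eq0 => /orP[|/eqP H]; first by rewrite mulf_eq0 (gt_eqF st) pnatr_eq0.
rewrite -[RHS]H; apply: eq_bigr => k _; congr cos.
by rewrite /t; field; rewrite gt_eqF.
Qed.

(** Discrete Wiener-Khinchin: the power spectrum of a window transforms back to its autocorrelation.
    Padding to length M with m + j <= M keeps the lags from wrapping around. *)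
Lemma sum_norm_dft_cos {R : realType} (m M j : nat) (g : nat -> R) :
  (m + j <= M)%N ->
  \sum_(k < M) ((\sum_(i < m) g i * cos (i%:R * (2 * pi * k%:R / M%:R))) ^+ 2 +
                (\sum_(i < m) g i * sin (i%:R * (2 * pi * k%:R / M%:R))) ^+ 2) *
    cos (j%:R * (2 * pi * k%:R / M%:R)) =
  M%:R * \sum_(i < m | (i + j < m)%N) g i * g (i + j)%N.
Proof.
move=> mjM.
transitivity (\sum_(k < M) \sum_(i < m) \sum_(l < m) g i * g l *
    cos (((i + j)%:R - l%:R) * (2 * pi * k%:R / M%:R))).
  apply: eq_bigr => k _; set th := 2 * pi * k%:R / M%:R.
  transitivity (\sum_(i < m) \sum_(l < m)
    ((g i * cos (i%:R * th) * cos (j%:R * th) - g i * sin (i%:R * th) * sin (j%:R * th)) *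
      (g l * cos (l%:R * th)) +
     (g i * sin (i%:R * th) * cos (j%:R * th) + g i * cos (i%:R * th) * sin (j%:R * th)) *
      (g l * sin (l%:R * th)))); last first.
    apply: eq_bigr => i _; apply: eq_bigr => l _.
    have -> : ((i + j)%:R - l%:R) * th = i%:R * th + j%:R * th - l%:R * th.
      by rewrite natrD; ring.
    by rewrite cosB cosD sinD; ring.
  rewrite [RHS](eq_bigr _ (fun i _ => big_split _ _ _ _ _)) big_split/=.
  under [X in _ = X + _]eq_bigr do rewrite -mulr_sumr.
  under [X in _ = _ + X]eq_bigr do rewrite -mulr_sumr.
  rewrite -!mulr_suml sumrB big_split/= -!mulr_suml; ring.
rewrite exchange_big/= mulr_sumr (bigID (fun i : 'I_m => (i + j < m)%N))/=.
rewrite [X in _ + X]big1 ?addr0 => [|i ijm]; last first.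
  rewrite exchange_big/= big1// => l _.
  rewrite -mulr_sumr sum_cos_root_of_unity; [|have := ltn_ord l; have := ltn_ord i; lia..].
  case: eqP => [ijl|_]; last by rewrite mulr0.
  by move: ijm; rewrite ijl ltn_ord.
apply: eq_bigr => i ijm; rewrite exchange_big/= (bigD1 (Ordinal ijm))//=.
rewrite [X in _ + X]big1 ?addr0 => [|l /eqP li]; rewrite -mulr_sumr sum_cos_root_of_unity.
- by rewrite eqxx mulrC.
- have := ltn_ord i; lia.
- have := ltn_ord i; lia.
- by case: eqP => [ijl|_]; [case: li; apply: val_inj; rewrite /= ijl|rewrite mulr0].
- have := ltn_ord l; have := ltn_ord i; lia.
- have := ltn_ord l; have := ltn_ord i; lia.
Qed.

Lemma sum_sin_sqr {R : realType} (m : nat) : (1 < m)%N ->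
  \sum_(i < m) sin (pi * i%:R / m%:R) ^+ 2 = m%:R / 2 :> R.
Proof.
move=> m1; have m0 : m%:R != 0 :> R by rewrite pnatr_eq0; lia.
have H : \sum_(k < m) cos (2 * pi * k%:R / m%:R) = 0 :> R.
  apply: etrans (@sum_cos_root_of_unity R 1 0 m _ _); [|lia..].
  by apply: eq_bigr => k _; rewrite subr0 mul1r.
transitivity (\sum_(i < m) (1 / 2 - cos (2 * pi * i%:R / m%:R) / 2 : R)).
  apply: eq_bigr => i _; rewrite sin2cos2.
  have -> : 2 * pi * i%:R / m%:R = (pi * i%:R / m%:R) *+ 2 :> R.
    by rewrite -mulr_natr; field.
  by rewrite cos_mulr2n; lra.
rewrite sumrB -[X in _ - X]mulr_suml H mul0r subr0 sumr_const card_ord -mulr_natr; lra.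
Qed.

(** The sampled sine is an eigenvector of the discrete Laplacian, g(i+2) + g(i) = 2 cos (pi/m)
    g(i+1), and vanishes at both ends 0 and m. *)
Lemma sum_sin_mul_shift {R : realType} (m : nat) : (1 < m)%N ->
  \sum_(i < m) sin (pi * i%:R / m%:R) * sin (pi * i.+1%:R / m%:R) =
  cos (pi / m%:R) * \sum_(i < m) sin (pi * i%:R / m%:R) ^+ 2 :> R.
Proof.
move=> m1; have m0 : m%:R != 0 :> R by rewrite pnatr_eq0; lia.
set g := fun i : nat => sin (pi * i%:R / m%:R : R).
have g0 : g 0%N = 0 by rewrite /g mulr0 mul0r sin0.
have gS i : g i.+2 + g i = 2 * cos (pi / m%:R) * g i.+1.
  rewrite /g.
  have -> : pi * i.+2%:R / m%:R = pi * i.+1%:R / m%:R + pi / m%:R :> R.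
    by rewrite -(natr1 i.+1); field.
  have -> : pi * i%:R / m%:R = pi * i.+1%:R / m%:R - pi / m%:R :> R.
    by rewrite -(natr1 i); field.
  by rewrite sinD sinB; ring.
suff H n : 2 * (\sum_(i < n.+1) g i * g i.+1) =
    2 * cos (pi / m%:R) * (\sum_(i < n.+1) g i ^+ 2) + g n * g n.+1.
  have gm : g m = 0 by rewrite /g mulfK// sinpi.
  have := H m.-1; rewrite prednK; last lia.
  by rewrite gm mulr0; rewrite /g /=; lra.
elim: n => [|n IH]; first by rewrite !big_ord_recl !big_ord0/= g0; ring.
rewrite big_ord_recr/= [in RHS]big_ord_recr/= mulrDr IH.
have := gS n; move: (\sum_(i < n.+1) g i ^+ 2) => S h.
by transitivity (2 * cos (pi / m%:R) * S + g n.+1 * (g n.+2 + g n) + g n.+1 * g n.+2);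
  [ring|rewrite h; ring].
Qed.

(** The weights are the normalised power spectrum of the sine window padded to length M. Their
    cosine transform is its autocorrelation: cos (pi/m) at lag 1, which forces frequencies of order
    1/m in mean square, and 0 from lag m on, where the window no longer meets its shift. *)
Lemma bohman_weights {R : realType} (m M : nat) : (1 < m)%N -> (m < M)%N ->
  exists c w : 'I_M -> R,
    [/\ (forall k, 0 <= c k) /\ (forall k, 0 <= w k <= pi),
        \sum_k c k = 1,
        \sum_k c k * cos (w k) = cos (pi / m%:R),
        (forall j : nat, (m <= j)%N -> (m + j <= M)%N ->
           \sum_k c k * cos (w k * j%:R) = 0) &
        forall k : 'I_M, (2 * k <= M)%N -> w k = 2 * pi * k%:R / M%:R /\
           (w k * m%:R <= 1 -> m%:R / (8 * M%:R) <= c k)].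
Proof.
move=> m1 mM; pose g i : R := sin (pi * i%:R / m%:R).
have m0 : 0 < m%:R :> R by rewrite ltr0n; lia.
have M0 : 0 < M%:R :> R by rewrite ltr0n; lia.
have pi0 := pi_gt0 R.
pose th (k : nat) : R := 2 * pi * k%:R / M%:R.
pose A k : R := \sum_(i < m) g i * cos (i%:R * th k).
pose B k : R := \sum_(i < m) g i * sin (i%:R * th k).
pose G : R := \sum_(i < m) g i ^+ 2.
have GE : G = m%:R / 2 by exact: sum_sin_sqr.
have G0 : 0 < G by rewrite GE; lra.
pose c (k : 'I_M) := (A k ^+ 2 + B k ^+ 2) / (M%:R * G).
(* Reflecting frequencies above pi keeps all cosines at integer lags and puts [w] in [0, pi], where
   1 - cos w >= w^2 / 8 is available. *)
pose w (k : 'I_M) := if (2 * k <= M)%N then th k else 2 * pi - th k.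
have thM k : 0 <= th k by rewrite /th divr_ge0// mulr_ge0// mulr_ge0// ltW.
have cosw k j : cos (w k * j%:R) = cos (j%:R * th k).
  rewrite /w; case: ifP => _; first by rewrite mulrC.
  rewrite -cosN mulrBl opprB -(periodicn (@cosD2pi R) j) -(mulr_natr _ j) -(mulr_natr pi 2).
  by congr cos; ring.
have sumc j : (m + j <= M)%N -> \sum_k c k * cos (w k * j%:R) =
    (\sum_(i < m | (i + j < m)%N) g i * g (i + j)%N) / G.
  move=> mjM.
  transitivity ((\sum_(k < M) (A k ^+ 2 + B k ^+ 2) * cos (j%:R * th k)) / (M%:R * G)).
    rewrite mulr_suml; apply: eq_bigr => k _; rewrite cosw /c; ring.
  rewrite sum_norm_dft_cos//; field.
  by rewrite gt_eqF//= gt_eqF.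
have sc : \sum_k c k = 1.
  have := sumc 0%N; rewrite addn0 => /(_ (ltnW mM)).
  under eq_bigr do rewrite mulr0 cos0 mulr1.
  move=> ->; under eq_bigl do rewrite addn0 ltn_ord.
  under eq_bigr do rewrite addn0 -expr2.
  by rewrite divff// gt_eqF.
exists c, w; split => //.
- split=> k; first by rewrite divr_ge0 ?addr_ge0 ?sqr_ge0// mulr_ge0// ltW.
  have kM : k%:R < M%:R :> R by rewrite ltr_nat.
  have thE : th k * M%:R = 2 * pi * k%:R by rewrite /th divfK// gt_eqF.
  rewrite /w; case: leqP => h; rewrite ?thM ?subr_ge0/=.
    rewrite -(ler_pM2r M0) thE.
    have : (2 * k)%:R <= M%:R :> R by rewrite ler_nat.
    rewrite natrM; nra.
  have h' : M%:R <= (2 * k)%:R :> R by rewrite ler_nat; lia.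
  rewrite natrM in h'; apply/andP; split.
    rewrite -(ler_pM2r M0) thE; nra.
  rewrite lerBlDl -lerBlDr -(ler_pM2r M0) thE; nra.
- have := sumc 1%N; rewrite addn1 => /(_ mM).
  under eq_bigr do rewrite mulr1.
  move=> ->.
  have -> : \sum_(i < m | (i + 1 < m)%N) g i * g (i + 1)%N = \sum_(i < m) g i * g i.+1.
    rewrite [RHS](bigID (fun i : 'I_m => (i + 1 < m)%N))/=.
    rewrite [X in _ + X]big1 ?addr0 => [|i im]; first by apply: eq_bigr => l _; rewrite addn1.
    suff -> : i.+1 = m by rewrite /g mulfK ?gt_eqF// sinpi mulr0.
    by have := ltn_ord i; lia.
  rewrite /g sum_sin_mul_shift// -/g mulfK//.
  by rewrite -/G gt_eqF.
- move=> j mj mjM; rewrite sumc// big1 ?mul0r// => i; lia.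
- move=> k kM; rewrite /w kM; split => // wm.
  have gi (i : 'I_m) : 0 <= g i <= 1.
    rewrite /g sin_le1 andbT sin_ge0_pi//; apply/andP; split.
      by rewrite divr_ge0// mulr_ge0// ltW.
    by rewrite ler_pdivrMr// ler_pM2l// ler_nat ltnW.
  (* All angles are at most 1, so their cosines are at least 1/2, and g >= g^2 as g lies in [0, 1].
     Then c k >= (G/2)^2 / (M G) = m / (8 M). *)
  have AG : G / 2 <= A k.
    rewrite /G /A mulr_suml; apply: ler_sum => l _.
    have /andP[g0 g1] := gi l.
    have lt1 : l%:R * th k <= 1.
      by apply: le_trans wm; rewrite mulrC ler_wpM2l// ler_nat ltnW.
    have lt2 : (l%:R * th k) ^+ 2 <= 1 by rewrite exprn_ile1// mulr_ge0.
    have h : 1 / 2 <= cos (l%:R * th k).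
      by have := one_sub_cos_le (l%:R * th k); lra.
    by rewrite expr2 -mulrA ler_wpM2l//; lra.
  rewrite /c ler_pdivlMr ?mulr_gt0//.
  have -> : m%:R / (8 * M%:R) * (M%:R * G) = (G / 2) ^+ 2.
    by rewrite GE; field; rewrite gt_eqF.
  have := sqr_ge0 (B k); nra.
Qed.

(** Multiplying the frequencies by m places the integer lags on a grid of step 1/m, so the cosine
    sum vanishes at grid points beyond 1 and is small between them. The second moment will serve
    small scales and the mass near frequency zero large ones. *)
Lemma bohman_kernel {R : realType} : exists B b : R, [/\ 0 < B, 0 < b &
  forall eta L : R, 0 < eta -> exists (n : nat) (c u : 'I_n -> R),
    [/\ (forall k, 0 <= c k), \sum_k c k = 1, \sum_k c k * u k ^+ 2 <= B,
        (forall r, 1 <= r -> b / r <= \sum_(k | `|u k| <= r^-1) c k) &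
        forall x : R, 1 <= `|x| <= L -> `|\sum_k c k * cos (u k * x)| <= eta]].
Proof.
have pi0 := pi_gt0 R.
have half_lt (a e : nat) : (2 * a <= e)%N -> (0 < e)%N -> (a < e)%N by lia.
exists (4 * pi ^+ 2), (16 * pi)^-1; split; rewrite ?mulr_gt0 ?invr_gt0 ?exprn_gt0 ?mulr_gt0//.
move=> eta L eta0.
set B : R := 4 * pi ^+ 2.
have B0 : 0 < B by rewrite mulr_gt0// exprn_gt0.
(* Chosen so that the error (1 + B) / m made between grid points is at most [eta]; [M] below leaves
   room for all lags up to m |L|. *)
pose m := (Num.trunc ((1 + B) / eta)).+2.
have m1 : (1 < m)%N by [].
have m0 : 0 < m%:R :> R by rewrite ltr0n.
have meta : (1 + B) / m%:R <= eta.
  rewrite ler_pdivrMr// mulrC -ler_pdivrMr//.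
  apply: le_trans (ltW (truncnS_gt _)) _.
  by rewrite ler_nat /m.
pose M := (m + m + (Num.trunc (m%:R * `|L|)).+1)%N.
have mM : (m < M)%N by rewrite /M; lia.
have M0 : 0 < M%:R :> R by rewrite ltr0n; lia.
have [c [w [[c0 w0] sc cw1 cwj cwk]]] := @bohman_weights R m M m1 mM.
have cw2 : \sum_k c k * (w k * m%:R) ^+ 2 <= B.
  have : \sum_k c k * (w k * m%:R) ^+ 2 <= (\sum_k c k * (1 - cos (w k))) * (8 * m%:R ^+ 2).
    rewrite mulr_suml; apply: ler_sum => k _.
    rewrite -mulrA ler_wpM2l//.
    have := one_sub_cos_ge _ (w0 k).
    rewrite exprMn => H.
    have := sqr_ge0 (m%:R : R); nra.
  move=> /le_trans; apply.
  under eq_bigr do rewrite mulrBr mulr1.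
  rewrite sumrB sc cw1.
  have := one_sub_cos_le (pi / m%:R : R).
  rewrite expr_div_n => h.
  apply: le_trans (_ : pi ^+ 2 / m%:R ^+ 2 / 2 * (8 * m%:R ^+ 2) <= _).
    by rewrite ler_wpM2r// mulr_ge0// sqr_ge0.
  rewrite /B le_eqVlt; apply/orP; left; apply/eqP; field.
  by rewrite gt_eqF.
exists M, c, (fun k => w k * m%:R); split => //.
- move=> r r1; have r0 : 0 < r by lra.
  (* The indices k <= x have m w k <= 1/r. Counting k = 0 there are at least x of them, each of
     weight at least m / (8 M), hence the mass 1 / (16 pi r). *)
  pose x : R := M%:R / (2 * pi * m%:R * r).
  have x0 : 0 <= x by rewrite divr_ge0// ?mulr_ge0 ?ltW.
  pose q := Num.trunc x.
  have qx : q%:R <= x by rewrite truncn_le.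
  have x2M : 2 * x <= M%:R.
    rewrite /x mulrA ler_pdivrMr ?mulr_gt0// mulrC ler_pM2l//.
    have pi1 : 1 <= pi :> R by have := pi_ge2 R; lra.
    have : 1 <= pi * m%:R * r by rewrite !mulr_ege1// ler1n.
    lra.
  have q2M : (2 * q <= M)%N.
    rewrite -(ler_nat R) natrM; lra.
  have qM : (q < M)%N by apply: half_lt q2M _; rewrite -(ltr0n R).
  have h (k : 'I_M) : (k <= q)%N -> `|w k * m%:R| <= r^-1 /\ m%:R / (8 * M%:R) <= c k.
    move=> kq; have [wk ck] := cwk k (leq_trans (leq_mul (leqnn 2) kq) q2M).
    have wr : w k * m%:R <= r^-1.
      rewrite -(ler_pM2r r0) mulVf ?gt_eqF// wk.
      have kx : k%:R <= x by apply: le_trans qx; rewrite ler_nat.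
      have : 2 * pi * m%:R * r * k%:R <= M%:R.
        apply: le_trans (_ : 2 * pi * m%:R * r * x <= _).
          by rewrite ler_wpM2l// !mulr_ge0// ltW.
        by rewrite /x mulrC divfK// gt_eqF// !mulr_gt0.
      move=> H.
      have -> : 2 * pi * k%:R / M%:R * m%:R * r = (2 * pi * m%:R * r * k%:R) / M%:R by ring.
      by rewrite ler_pdivrMr// mul1r.
    split; first by rewrite ger0_norm// mulr_ge0//; case/andP: (w0 k).
    apply: ck; apply: le_trans wr _.
    by rewrite invf_le1.
  apply: le_trans (_ : \sum_(k < M | (k <= q)%N) c k <= _); last first.
    rewrite [leRHS](bigID (fun k : 'I_M => (k <= q)%N))/=.
    rewrite -[leLHS]addr0 lerD// ?sumr_ge0//.
    rewrite [leRHS](eq_bigl (fun k : 'I_M => (k <= q)%N))// => k.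
    by apply/andb_idl => /h[].
  apply: le_trans (_ : \sum_(k < M | (k <= q)%N) (m%:R / (8 * M%:R)) <= _); last first.
    by apply: ler_sum => k /h[].
  rewrite -(big_ord_widen M (fun=> m%:R / (8 * M%:R)) qM) sumr_const card_ord -[leRHS]mulr_natr.
  apply: le_trans (_ : m%:R / (8 * M%:R) * x <= _); last first.
    by rewrite ler_wpM2l ?divr_ge0 ?mulr_ge0// ltW// truncnS_gt.
  rewrite /x le_eqVlt; apply/orP; left; apply/eqP.
  move: (pi : R) pi0 => p p0; field.
  by rewrite (gt_eqF r0) (gt_eqF m0) (gt_eqF M0) (gt_eqF p0).
- move=> x /andP[x1 xL].
  pose j := Num.trunc (m%:R * `|x|).
  have mx0 : 0 <= m%:R * `|x| by rewrite mulr_ge0.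
  have jx : j%:R <= m%:R * `|x| by rewrite truncn_le.
  have xj : m%:R * `|x| <= j%:R + 1 by rewrite natr1 ltW// truncnS_gt.
  have mj : (m <= j)%N by rewrite truncn_ge_nat// ler_peMr// ltW.
  have jM : (m + j <= M)%N.
    have : (j <= Num.trunc (m%:R * `|L|))%N.
      by rewrite le_truncn// ler_wpM2l// (le_trans xL)// ler_norm.
    by move=> jt; rewrite /M -addnA leq_add2l addnS -addSn (leq_trans jt)// leq_addl.
  (* The sum vanishes at the lag [j] just below m |x|, so only the change of each cosine remains: at
     most w k, which is at most (1 + (m w k)^2) / m. *)
  have -> : \sum_k c k * cos (w k * m%:R * x) =
      \sum_k (c k * cos (w k * m%:R * x) - c k * cos (w k * j%:R)).
    by rewrite sumrB cwj// subr0.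
  apply: le_trans (ler_norm_sum _ _ _) _.
  apply: le_trans (_ : \sum_k c k * (1 + (w k * m%:R) ^+ 2) / m%:R <= _); last first.
    rewrite -mulr_suml; apply: le_trans meta.
    rewrite ler_pM2r ?invr_gt0//.
    under eq_bigr do rewrite mulrDr mulr1.
    by rewrite big_split/= sc lerD2l.
  apply: ler_sum => k _.
  rewrite -mulrBr normrM (ger0_norm (c0 k)) -[leRHS]mulrA ler_wpM2l//.
  have wk0 : 0 <= w k by case/andP: (w0 k).
  have -> : cos (w k * m%:R * x) = cos (w k * m%:R * `|x|).
    by rewrite -[LHS]cos_norm -[RHS]cos_norm !normrM normr_id.
  apply: le_trans (abs_cos_sub_le _ _) _.
  rewrite -!mulrA -mulrBr normrM (ger0_norm wk0).
  apply: le_trans (_ : w k * 1 <= _).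
    by rewrite ler_wpM2l// ler_norml; apply/andP; split; lra.
  rewrite mulr1 ler_pdivlMr//.
  have := mulr_ge0 wk0 (ltW m0); set z := w k * m%:R; nra.
Qed.

(** * Clarkson's inequality and bounded expectations *)

(** Young's inequality for z^p and 1 with exponents 1/p and 1/(1-p): a concave power lies below its
    tangent at 1. *)
Lemma powR_le_bernoulli {R : realType} (p z : R) : 0 < p < 1 -> 0 <= z ->
  z `^ p <= 1 + p * (z - 1).
Proof.
move=> /andP[p0 p1] z0.
have q0 : 0 < (1 - p)^-1 by rewrite invr_gt0; lra.
have := @conjugate_powR R (z `^ p) 1 p^-1 (1 - p)^-1 (powR_ge0 _ _) ler01.
rewrite invr_gt0 p0 q0 !invrK => /(_ isT isT).
rewrite subrKC => /(_ erefl).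
rewrite mulr1 powR1 -powRrM divff ?gt_eqF// powRr1//; lra.
Qed.

Lemma powRD_le {R : realType} (p s t : R) : 0 < p <= 1 -> 0 <= s -> 0 <= t ->
  (s + t) `^ p <= s `^ p + t `^ p.
Proof.
move=> /andP[p0 p1] s0 t0.
have [w0|w0] := eqVneq (s + t) 0.
  by rewrite w0 powR0 ?gt_eqF// addr_ge0// powR_ge0.
have {}w0 : 0 < s + t by rewrite lt_neqAle eq_sym w0 addr_ge0.
have H x : 0 <= x <= s + t -> x / (s + t) * (s + t) `^ p <= x `^ p.
  move=> /andP[x0 xw]; rewrite -{2}(divfK (lt0r_neq0 w0) x) powRM//; last 2 first.
  - by rewrite divr_ge0// ltW.
  - exact: ltW.
  rewrite ler_wpM2r ?powR_ge0//.
  have [->|x1] := eqVneq x 0; first by rewrite mul0r powR_ge0.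
  by rewrite ger1_powR// divr_gt0 ?ler_pdivrMr ?mul1r//= lt_neqAle eq_sym x1.
apply: le_trans (_ : (s / (s + t) + t / (s + t)) * (s + t) `^ p <= _).
  by rewrite -mulrDl divff ?gt_eqF// mul1r.
by rewrite mulrDl lerD// H//; apply/andP; split; lra.
Qed.

(** With p = alpha/2, bound both terms by the tangent of the p-th power at w = a^2 + b^2. Since
    (a+b)^2 and (a-b)^2 average to w, the slopes cancel and 2 w^p remains, which subadditivity
    splits. *)
Lemma powR_parallelogram_le {R : realType} (alpha a b : R) : 0 < alpha < 2 ->
  `|a + b| `^ alpha + `|a - b| `^ alpha <= 2 * `|a| `^ alpha + 2 * `|b| `^ alpha.
Proof.
move=> /andP[alpha0 alpha2]; set p := alpha / 2.
have p0 : 0 < p by rewrite /p; lra.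
have p1 : p < 1 by rewrite /p; lra.
have E x : `|x| `^ alpha = (x ^+ 2) `^ p.
  have -> : alpha = 2%:R * p by rewrite /p; lra.
  by rewrite powRrM powR_mulrn// real_normK ?num_real.
rewrite !E.
have [w0|w0] := eqVneq (a ^+ 2 + b ^+ 2) 0.
  have /eqP := w0; rewrite paddr_eq0 ?sqr_ge0// !sqrf_eq0 => /andP[/eqP-> /eqP->].
  by rewrite !(addr0, subr0, expr0n, powR0) ?gt_eqF// !mulr0 addr0.
have {}w0 : 0 < a ^+ 2 + b ^+ 2 by rewrite lt_neqAle eq_sym w0 addr_ge0// sqr_ge0.
set w := a ^+ 2 + b ^+ 2 in w0.
have H u : 0 <= u -> u `^ p <= w `^ p * (1 + p * (u / w - 1)).
  move=> u0; rewrite -{1}(divfK (lt0r_neq0 w0) u) mulrC powRM ?divr_ge0 ?(ltW w0)//.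
  by rewrite ler_wpM2l ?powR_ge0// powR_le_bernoulli ?p0// divr_ge0// ltW.
apply: le_trans (_ : 2 * w `^ p <= _); last first.
  rewrite -mulrDr ler_pM2l// powRD_le ?sqr_ge0// p0; exact: ltW.
apply: le_trans (lerD (H _ (sqr_ge0 _)) (H _ (sqr_ge0 _))) _.
rewrite -mulrDr mulrC ler_wpM2r ?powR_ge0// le_eqVlt; apply/orP; left; apply/eqP.
rewrite /w; field.
by rewrite gt_eqF.
Qed.

Section bounded_expectation.
Context {R : realType} {d : measure_display} {Omega : measurableType d}
  (P : probability Omega R).

Definition bounded_measurable (f : Omega -> R) :=
  measurable_fun setT f /\ exists M, forall w, `|f w| <= M.

Lemma bounded_measurable_integrable f : bounded_measurable f ->
  P.-integrable setT (EFin \o f).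
Proof.
move=> [mf [M fM]]; apply: measurable_bounded_integrable => //.
  by rewrite (le_lt_trans (probability_le1 P measurableT))// ltry.
by exists M; split; rewrite ?num_real// => x Mx w _; exact: le_trans (fM w) (ltW Mx).
Qed.

Lemma bounded_measurable_sum (I : Type) (s : seq I) (f : I -> Omega -> R) :
  (forall i, bounded_measurable (f i)) ->
  bounded_measurable (fun w => \sum_(i <- s) f i w).
Proof.
move=> bf; split; first by apply: measurable_sum => i; case: (bf i).
elim: s => [|i s [M sM]]; first by exists 0 => w; rewrite big_nil normr0.
have [_ [N fN]] := bf i.
exists (N + M) => w; rewrite big_cons.
exact: le_trans (ler_normD _ _) (lerD _ _).
Qed.

Lemma bounded_measurableM (f g : Omega -> R) :
  bounded_measurable f -> bounded_measurable g ->
  bounded_measurable (fun w => f w * g w).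
Proof.
move=> [mf [M fM]] [mg [N gN]]; split; first exact: measurable_funM.
by exists (M * N) => w; rewrite normrM ler_pM.
Qed.

Lemma bounded_measurableD (f g : Omega -> R) :
  bounded_measurable f -> bounded_measurable g ->
  bounded_measurable (fun w => f w + g w).
Proof.
move=> [mf [M fM]] [mg [N gN]]; split; first exact: measurable_funD.
by exists (M + N) => w; exact: le_trans (ler_normD _ _) (lerD _ _).
Qed.

Lemma bounded_measurable_cst (c : R) : bounded_measurable (fun=> c).
Proof. by split; [exact: measurable_cst|exists `|c|]. Qed.

Lemma bounded_measurable_prod (I : Type) (s : seq I) (f : I -> Omega -> R) :
  (forall i, bounded_measurable (f i)) ->
  bounded_measurable (fun w => \prod_(i <- s) f i w).
Proof.
move=> bf; elim: s => [|i s IH].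
  by under eq_fun do rewrite big_nil; exact: bounded_measurable_cst.
by under eq_fun do rewrite big_cons; exact: bounded_measurableM.
Qed.

Lemma bounded_measurable_cos (f : Omega -> R) : measurable_fun setT f ->
  bounded_measurable (fun w => cos (f w)).
Proof.
move=> mf; split; last by exists 1 => w; exact: cos_max.
apply: (measurableT_comp (f := cos)) mf.
by apply: continuous_measurable_fun => x; exact: continuous_cos.
Qed.

Lemma bounded_measurable_indic (A : set Omega) : measurable A ->
  bounded_measurable (\1_A : Omega -> R).
Proof.
move=> mA; split; first exact: measurable_indic.
by exists 1 => w; rewrite indicE; case: (_ \in _); rewrite ?normr1 ?normr0.
Qed.

Lemma Rintegral_sum (I : Type) (s : seq I) (f : I -> Omega -> R) :
  (forall i, bounded_measurable (f i)) ->
  \int[P]_w (\sum_(i <- s) f i w) = \sum_(i <- s) \int[P]_w f i w.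
Proof.
move=> bf; elim: s => [|i s IH].
  rewrite big_nil; under eq_Rintegral do rewrite big_nil.
  by rewrite Rintegral_cst// mul0r.
rewrite big_cons -IH -RintegralD//; last 2 first.
- exact: bounded_measurable_integrable.
- exact/bounded_measurable_integrable/bounded_measurable_sum.
by apply: eq_Rintegral => w _; rewrite big_cons.
Qed.

Lemma Rintegral_scale (c : R) (f : Omega -> R) : bounded_measurable f ->
  \int[P]_w (c * f w) = c * \int[P]_w f w.
Proof. by move=> bf; rewrite RintegralZl//; exact: bounded_measurable_integrable. Qed.

Lemma Rintegral_le (f g : Omega -> R) :
  bounded_measurable f -> bounded_measurable g -> (forall w, f w <= g w) ->
  \int[P]_w f w <= \int[P]_w g w.
Proof.
by move=> bf bg fg; apply: le_Rintegral => //; exact: bounded_measurable_integrable.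
Qed.

Lemma Rintegral_indic_setT (A : set Omega) : measurable A ->
  \int[P]_w (\1_A w : R) = fine (P A).
Proof. by move=> mA; rewrite /Rintegral integral_indic// setIT. Qed.

End bounded_expectation.

(** * Correlation of cosine sums *)

Lemma all_flattenE (T : Type) (p : pred T) (ss : seq (seq T)) :
  all p (flatten ss) = all (all p) ss.
Proof. by elim: ss => //= s ss <-; rewrite all_cat. Qed.

Section positive_cosine_sums.
Context {R : realType} {d : measure_display} {Omega : measurableType d}
  (P : probability Omega R) (n : nat) (Y : 'I_n -> {RV P >-> R})
  (Q : ('I_n -> R) -> R).
Hypothesis charY : forall th : 'I_n -> R,
  ('E_P[fun w => cos (\sum_(i < n) th i * Y i w)] = (expR (- Q th))%:E)%E.
Hypothesis Q_parallelogram : forall th ta : 'I_n -> R,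
  Q (fun i => th i + ta i) + Q (fun i => th i - ta i) <= 2 * Q th + 2 * Q ta.

Definition linear_form (th : 'I_n -> R) (w : Omega) : R := \sum_(i < n) th i * Y i w.

(** Explicit lists of coefficients and frequencies make a product again such a list, with its
    expectation read off term by term. *)
Definition cosine_sum (s : seq (R * ('I_n -> R))) (w : Omega) : R :=
  \sum_(x <- s) x.1 * cos (linear_form x.2 w).

Lemma measurable_linear_form th : measurable_fun setT (linear_form th).
Proof.
apply: measurable_sum => i; apply: measurable_funM => //.
Qed.

Lemma bounded_cos_linear_form th : bounded_measurable (fun w => cos (linear_form th w)).
Proof. exact/bounded_measurable_cos/measurable_linear_form. Qed.

Lemma Rintegral_cosine_sum s :
  \int[P]_w cosine_sum s w = \sum_(x <- s) x.1 * expR (- Q x.2).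
Proof.
rewrite Rintegral_sum => [|x]; last first.
  by apply: bounded_measurableM; [exact: bounded_measurable_cst|exact: bounded_cos_linear_form].
apply: eq_bigr => x _; rewrite Rintegral_scale; last exact: bounded_cos_linear_form.
by congr (_ * _); have := charY x.2; rewrite unlock => H; rewrite /Rintegral H.
Qed.

Definition cosine_mul (x y : R * ('I_n -> R)) : seq (R * ('I_n -> R)) :=
  [:: (x.1 * y.1 / 2, fun i => x.2 i + y.2 i); (x.1 * y.1 / 2, fun i => x.2 i - y.2 i)].

Lemma cosine_mulE s t w : cosine_sum s w * cosine_sum t w =
  cosine_sum (flatten [seq flatten [seq cosine_mul x y | y <- t] | x <- s]) w.
Proof.
rewrite /cosine_sum big_flatten/= big_map mulr_suml; apply: eq_bigr => x _.
rewrite big_flatten/= big_map mulr_sumr; apply: eq_bigr => y _.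
rewrite !big_cons big_nil/= addr0.
have -> : linear_form (fun i => x.2 i + y.2 i) w = linear_form x.2 w + linear_form y.2 w.
  by rewrite -big_split/=; apply: eq_bigr => i _; rewrite mulrDl.
have -> : linear_form (fun i => x.2 i - y.2 i) w = linear_form x.2 w - linear_form y.2 w.
  by rewrite -sumrB; apply: eq_bigr => i _; rewrite mulrBl.
rewrite cosB cosD; lra.
Qed.

(** The correlation inequality for two single cosines. AM-GM gives exp(-A) + exp(-B) >= 2
    exp(-(A+B)/2), and the parallelogram bound gives (A+B)/2 <= Q x.2 + Q y.2. *)
Lemma cosine_mul_ge x y : 0 <= x.1 -> 0 <= y.1 ->
  x.1 * expR (- Q x.2) * (y.1 * expR (- Q y.2)) <=
  \sum_(z <- cosine_mul x y) z.1 * expR (- Q z.2).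
Proof.
move=> x0 y0; rewrite !big_cons big_nil/= addr0 -mulrDr.
set A := Q (fun i => x.2 i + y.2 i); set B := Q (fun i => x.2 i - y.2 i).
rewrite mulrACA -expRD -opprD -[leRHS]mulrA ler_wpM2l ?mulr_ge0// mulrC ler_pdivlMr//.
apply: le_trans (_ : expR (- ((A + B) / 2)) * 2 <= _).
  by rewrite ler_wpM2r// ler_expR lerN2 ler_pdivrMr//; have := Q_parallelogram x.2 y.2; rewrite -/A -/B; lra.
have -> : expR (- ((A + B) / 2)) = expR (- A / 2) * expR (- B / 2).
  by rewrite -expRD; congr expR; field.
have -> : expR (- A) = expR (- A / 2) ^+ 2 by rewrite expr2 -expRD; congr expR; field.
have -> : expR (- B) = expR (- B / 2) ^+ 2 by rewrite expr2 -expRD; congr expR; field.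
have := sqr_ge0 (expR (- A / 2) - expR (- B / 2)); rewrite sqrrB; lra.
Qed.

(** The product is returned as a list [t] with nonnegative coefficients because the induction
    multiplies it by one more factor. The empty product is the cosine of the zero form. *)
Lemma cosine_sum_prod_ge (ss : seq (seq (R * ('I_n -> R)))) :
  all (all (fun x => 0 <= x.1)) ss ->
  exists t, [/\ all (fun x : R * ('I_n -> R) => 0 <= x.1) t,
    (forall w, \prod_(s <- ss) cosine_sum s w = cosine_sum t w) &
    \prod_(s <- ss) \int[P]_w cosine_sum s w <= \int[P]_w cosine_sum t w].
Proof.
elim: ss => [_|s ss IH /= /andP[s0 /IH[t [t0 tE tle]]]].
  have Q0 : \int[P]_w cosine_sum [:: (1, fun=> 0)] w = 1.
    transitivity (\int[P]_w (1 : R)).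
      apply: eq_Rintegral => w _.
      rewrite /cosine_sum big_seq1/= /linear_form big1 ?cos0 ?mul1r// => i _.
      by rewrite mul0r.
    rewrite Rintegral_cst// mul1r; exact: (congr1 fine (probability_setT P)).
  exists [:: (1, fun=> 0)]; split => [|w|]; rewrite ?big_nil ?Q0 /= ?ler01//.
  rewrite /cosine_sum big_seq1/= /linear_form big1 ?cos0 ?mul1r// => i _.
  by rewrite mul0r.
have nonneg (s' : seq (R * ('I_n -> R))) : all (fun x => 0 <= x.1) s' ->
    forall F G : R * ('I_n -> R) -> R, (forall x, 0 <= x.1 -> F x <= G x) ->
    \sum_(x <- s') F x <= \sum_(x <- s') G x.
  move=> + F G FG; elim: s' => [_|x s' IHs /= /andP[x0 s'0]]; first by rewrite !big_nil.
  by rewrite !big_cons lerD ?FG ?IHs.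
exists (flatten [seq flatten [seq cosine_mul x y | y <- t] | x <- s]); split.
- rewrite all_flattenE all_map; apply: sub_all s0 => x x0 /=.
  rewrite all_flattenE all_map; apply: sub_all t0 => y y0 /=.
  by rewrite divr_ge0 ?mulr_ge0.
- by move=> w; rewrite big_cons tE cosine_mulE.
rewrite big_cons.
apply: le_trans (ler_wpM2l _ tle) _.
  rewrite Rintegral_cosine_sum; apply: le_trans (nonneg s s0 (fun=> 0) _ _).
    by rewrite big1.
  by move=> x x0; rewrite mulr_ge0// expR_ge0.
rewrite !Rintegral_cosine_sum big_flatten/= big_map mulr_suml.
apply: (nonneg) => // x x0; rewrite big_flatten/= big_map mulr_sumr.
by apply: (nonneg) => // y y0; exact: cosine_mul_ge.
Qed.

Lemma Rintegral_prod_cosine_ge (m k : nat) (th : 'I_m -> 'I_n -> R) (c u : 'I_k -> R) :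
  (forall j, 0 <= c j) ->
  \prod_(i < m) \sum_(j < k) c j * expR (- Q (fun l => u j * th i l)) <=
  \int[P]_w \prod_(i < m) \sum_(j < k) c j * cos (u j * linear_form (th i) w).
Proof.
move=> c0.
pose s i := [seq (c j, fun l => u j * th i l) | j <- index_enum 'I_k].
have [|t [_ tE tle]] := @cosine_sum_prod_ge [seq s i | i <- index_enum 'I_m].
  rewrite all_map; apply/allP => i _ /=; rewrite all_map; apply/allP => j _ /=.
  exact: c0.
apply: le_trans (_ : \int[P]_w cosine_sum t w <= _).
  apply: le_trans tle; rewrite big_map le_eqVlt; apply/orP; left; apply/eqP.
  by apply: eq_bigr => i _; rewrite Rintegral_cosine_sum big_map.
rewrite le_eqVlt; apply/orP; left; apply/eqP.
apply: eq_Rintegral => w _; rewrite -tE big_map; apply: eq_bigr => i _.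
rewrite /cosine_sum big_map; apply: eq_bigr => j _ /=.
by rewrite /linear_form mulr_sumr; congr (_ * cos _); apply: eq_bigr => l _; rewrite mulrA.
Qed.

End positive_cosine_sums.

(** * Small balls of finitely many increments *)

(** Here [r] is a scale over a tolerance. The power branch gives a geometric series over fine links;
    the logarithmic branch keeps coarse links, with large [r], cheap. *)
Definition small_ball_cost {R : realType} (alpha D r : R) : R :=
  D * Num.min (r `^ alpha) (1 + ln (Num.max 1 r)).

Lemma powR_abs_le1D_sqr {R : realType} (alpha u : R) : 0 < alpha < 2 ->
  `|u| `^ alpha <= 1 + u ^+ 2.
Proof.
move=> /andP[alpha0 alpha2]; have [u1|u1] := leP `|u| 1.
  apply: le_trans (_ : 1 <= _); last by rewrite lerDl sqr_ge0.
  have e1 : 1 `^ alpha = 1 :> R by rewrite powR1.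
  rewrite -[leRHS]e1; apply: ge0_ler_powR; rewrite ?nnegrE//; exact: ltW.
apply: le_trans (_ : `|u| `^ 2 <= _); first by rewrite ler_powR// ltW.
by rewrite powR_mulrn// real_normK ?num_real// lerDr.
Qed.

(** For small [r], linearise the exponential and use |u|^alpha <= 1 + u^2 with the second moment.
    Otherwise keep only the frequencies up to 1 / max(1, r): each retains at least exp(-1) of its
    weight. *)
Lemma expR_cost_le {R : realType} (alpha B b : R) : 0 < alpha < 2 -> 0 < B -> 0 < b ->
  exists2 D : R, 0 < D & forall (n : nat) (c u : 'I_n -> R),
    (forall k, 0 <= c k) -> \sum_k c k = 1 -> \sum_k c k * u k ^+ 2 <= B ->
    (forall r, 1 <= r -> b / r <= \sum_(k | `|u k| <= r^-1) c k) ->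
    forall r, 0 <= r ->
      expR (- small_ball_cost alpha D r) <=
      \sum_k c k * expR (- (r `^ alpha * `|u k| `^ alpha)).
Proof.
move=> alpha02 B0 b0; have /andP[alpha0 _] := alpha02.
pose c1 := 1 + `|ln b|.
have c10 : 1 <= c1 by rewrite /c1 lerDl.
have ia0 : 0 < alpha^-1 by rewrite invr_gt0.
(* For large [r], 2 (1 + B) r^alpha > 1 lets the first term pay for 1 + c1, and 1/alpha pays for ln
   r' <= r^alpha / alpha. For small [r], D >= 2 (1 + B) suffices. *)
pose D := 2 * (1 + B) * (1 + c1) + alpha^-1.
have D0 : 0 < D by rewrite /D; nra.
exists D => // n c u c0 sc cB cb r r0.
pose r' := Num.max 1 r.
have r'1 : 1 <= r' by rewrite le_max lexx.
have r'0 : 0 < r' by lra.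
have lr'0 : 0 <= ln r' by exact: ln_ge0.
have ra0 : 0 <= r `^ alpha by exact: powR_ge0.
have [small|large] := leP ((1 + B) * r `^ alpha) (1 / 2).
  have ra1 : r `^ alpha <= 1 by nra.
  apply: le_trans (_ : 1 - (1 + B) * r `^ alpha <= _); last first.
    apply: le_trans (_ : \sum_k (c k - c k * (1 + u k ^+ 2) * r `^ alpha) <= _); last first.
      apply: ler_sum => k _; rewrite -mulrA -[X in X - _]mulr1 -mulrBr ler_wpM2l//.
      apply: le_trans (expR_ge1Dx _); rewrite lerD2l lerN2 mulrC ler_wpM2r//.
      exact: powR_abs_le1D_sqr.
    rewrite sumrB -mulr_suml sc lerD2l lerN2 ler_wpM2r//.
    by under eq_bigr do rewrite mulrDr mulr1; rewrite big_split/= sc lerD2l.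
  rewrite /small_ball_cost -/r'.
  have -> : Num.min (r `^ alpha) (1 + ln r') = r `^ alpha by apply/min_idPl; lra.
  set x := (1 + B) * r `^ alpha in small *.
  have x0 : 0 <= x by rewrite /x mulr_ge0//; lra.
  apply: le_trans (_ : expR (- (2 * x)) <= _).
    rewrite ler_expR lerN2 /x mulrA ler_wpM2r// /D; nra.
  rewrite expRN -[leLHS]mul1r ler_pdivrMr ?expR_gt0//.
  (* The product is at least 1 exactly because 0 <= x <= 1/2. *)
  apply: le_trans (_ : (1 - x) * (1 + 2 * x) <= _); first by nra.
  by rewrite ler_wpM2l ?expR_ge1Dx//; lra.
have lr' : ln r' <= r `^ alpha / alpha.
  rewrite /r'; have [r1|/ltW r1] := leP 1 r; last first.
    by rewrite ln1 divr_ge0// ltW.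
  rewrite ler_pdivlMr// mulrC -ln_powR ltW// ln_sublinear// powR_gt0//; lra.
have costge : c1 + ln r' <= small_ball_cost alpha D r.
  rewrite /small_ball_cost -/r' minr_pMr; last exact: ltW.
  rewrite le_min; apply/andP; split; last first.
    have Dc : 1 + c1 <= D.
      have : 0 <= (1 + 2 * B) * (1 + c1) by rewrite mulr_ge0//; lra.
      by rewrite /D; lra.
    apply: le_trans (ler_wpM2r _ Dc); last by lra.
    have : 0 <= c1 * ln r' by rewrite mulr_ge0//; lra.
    lra.
  have : 1 * (1 + c1) <= (2 * ((1 + B) * r `^ alpha)) * (1 + c1).
    by rewrite ler_wpM2r//; lra.
  have -> : D * r `^ alpha = (2 * ((1 + B) * r `^ alpha)) * (1 + c1) + r `^ alpha / alpha.
    by rewrite /D; ring.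
  lra.
apply: le_trans (_ : expR (- (c1 + ln r')) <= _); first by rewrite ler_expR lerN2.
apply: le_trans (_ : expR (- 1) * (b / r') <= _).
  have bE : b = expR (ln b) by rewrite lnK.
  have rE : r'^-1 = expR (- ln r') by rewrite expRN lnK.
  rewrite rE [in leRHS]bE -!expRD ler_expR /c1.
  have := ler_norm (- ln b); rewrite normrN; lra.
apply: le_trans (ler_wpM2l (expR_ge0 _) (cb _ r'1)) _.
rewrite mulr_sumr [leRHS](bigID (fun k => `|u k| <= r'^-1))/=.
rewrite -[leLHS]addr0 lerD//; last first.
  by apply: sumr_ge0 => k _; rewrite mulr_ge0// expR_ge0.
apply: ler_sum => k uk; rewrite mulrC ler_wpM2l// ler_expR lerN2.
apply: le_trans (_ : r' `^ alpha * r'^-1 `^ alpha <= _).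
  apply: ler_pM; rewrite ?powR_ge0//; apply: ge0_ler_powR;
    rewrite ?nnegrE ?invr_ge0 ?(ltW r'0) ?(ltW alpha0)//.
  by rewrite le_max lexx orbT.
by rewrite -powRM ?invr_ge0 ?(ltW r'0)// divff ?gt_eqF// powR1.
Qed.

(** [Q] integrates |<theta, s>|^alpha against the spectral measure; the last property is Clarkson's
    inequality integrated in s. *)
Lemma SaS_vector_exponent {R : realType} {d : measure_display}
    {Omega : measurableType d} (P : probability Omega R) (alpha : R) (n : nat)
    (Y : 'I_n -> Omega -> R) : 0 < alpha < 2 -> SaS_vector P alpha Y ->
  exists Q : ('I_n -> R) -> R,
    [/\ forall th, 0 <= Q th,
      forall th : 'I_n -> R,
        ('E_P[fun w => cos (\sum_(i < n) th i * Y i w)] = (expR (- Q th))%:E)%E &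
      forall th ta : 'I_n -> R,
        Q (fun i => th i + ta i) + Q (fun i => th i - ta i) <= 2 * Q th + 2 * Q ta].
Proof.
move=> alpha02 [Gamma [G0 _ Gchar]].
pose lin (th : 'I_n -> R) (s : n.-tuple R) : R := \sum_(i < n) th i * tnth s i.
pose F th s := `|lin th s| `^ alpha.
exists (fun th => \int[Gamma]_s F th s); split => [th|th|th ta].
  by apply: Rintegral_ge0 => s _; exact: powR_ge0.
  have [+ _] := Gchar [tuple th i | i < n].
  under [X in ('E_P[X] = _)%E]eq_fun do under eq_bigr do rewrite tnth_mktuple.
  move=> ->; under [in LHS]eq_Rintegral => s _ do
    under eq_bigr do rewrite tnth_mktuple.
  by [].
have mlin th' : measurable_fun setT (lin th').
  apply: measurable_sum => i; apply: measurable_funM => //.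
  exact: measurable_tnth.
have mF th' : measurable_fun setT (F th').
  apply: (measurableT_comp (measurable_powR _)).
  exact: (measurableT_comp (@normr_measurable R setT)).
have mS : measurable (@unit_sphere R n).
  rewrite /unit_sphere -[X in measurable X]setTI.
  have msq : measurable_fun setT (fun s : n.-tuple R => \sum_(i < n) tnth s i ^+ 2).
    by apply: measurable_sum => i; apply: measurable_funX; exact: measurable_tnth.
  exact: (msq measurableT [set 1]).
(* [Gamma] has no mass off the sphere, and on it the integrand is bounded, which gives
   integrability. *)
have RS th' : \int[Gamma]_s F th' s = \int[Gamma]_(s in @unit_sphere R n) F th' s.
  rewrite /Rintegral (@ge0_negligible_integral _ _ _ Gamma setT (~` @unit_sphere R n))//.
  - by rewrite setTD setCK.
  - exact: measurableC.
  - exact/measurable_EFinP.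
  - by move=> s _; rewrite lee_fin powR_ge0.
have iF th' : Gamma.-integrable (@unit_sphere R n) (EFin \o F th').
  apply: measurable_bounded_integrable => //.
  - by rewrite ltey_eq fin_num_measure.
  - exact: measurable_funTS.
  exists ((\sum_(i < n) `|th' i|) `^ alpha); split; first exact: num_real.
  move=> x Mx s /= sS; apply: le_trans (ltW Mx).
  rewrite /F ger0_norm ?powR_ge0//; apply: ge0_ler_powR; rewrite ?nnegrE ?sumr_ge0//.
    by case/andP: alpha02 => /ltW.
  apply: le_trans (ler_norm_sum _ _ _) _; apply: ler_sum => i _.
  rewrite normrM ler_piMr// -(expr_le1 (n := 2))// real_normK ?num_real// -sS.
  by rewrite (bigD1 i)//= lerDl sumr_ge0// => j _; rewrite sqr_ge0.
have i2F th' : Gamma.-integrable (@unit_sphere R n) (EFin \o (fun s => 2 * F th' s)).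
  exact: (@integrableZl _ _ _ _ _ mS 2 _ (iF th')).
rewrite 4!RS.
pose SG f := \int[Gamma]_(s in @unit_sphere R n) f s.
have ED f g : Gamma.-integrable (@unit_sphere R n) (EFin \o f) ->
    Gamma.-integrable (@unit_sphere R n) (EFin \o g) ->
    SG f + SG g = SG (fun s => f s + g s) by move=> *; rewrite -RintegralD.
have EZ th' : 2 * SG (F th') = SG (fun s => 2 * F th' s) by rewrite -RintegralZl.
change (SG (F (fun i => th i + ta i)) + SG (F (fun i => th i - ta i)) <=
  2 * SG (F th) + 2 * SG (F ta)).
rewrite (ED _ _ (iF (fun i => th i + ta i)) (iF (fun i => th i - ta i))).
have -> : 2 * SG (F th) + 2 * SG (F ta) = SG (fun s => 2 * F th s + 2 * F ta s).
  exact: etrans (congr2 +%R (EZ th) (EZ ta)) (ED _ _ (i2F th) (i2F ta)).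
apply: le_Rintegral => //.
- exact: (integrableD mS (iF _) (iF _)).
- exact: (integrableD mS (i2F _) (i2F _)).
move=> s _; rewrite /F.
have -> : lin (fun i => th i + ta i) s = lin th s + lin ta s.
  by rewrite -big_split/=; apply: eq_bigr => i _; rewrite mulrDl.
have -> : lin (fun i => th i - ta i) s = lin th s - lin ta s.
  by rewrite -sumrB; apply: eq_bigr => i _; rewrite mulrBl.
exact: powR_parallelogram_le.
Qed.

Lemma exists_small_tail {R : realType} {d : measure_display}
    {Omega : measurableType d} (P : probability Omega R) (f : Omega -> R) (eta : R) :
  measurable_fun setT f -> 0 < eta ->
  exists L : R, measurable [set w | L < f w] /\ fine (P [set w | L < f w]) <= eta.
Proof.
move=> mf eta0.
have mA (L : R) : measurable [set w | L < f w].
  rewrite -[X in measurable X]setTI.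
  have -> : [set w | L < f w] = f @^-1` `]L, +oo[.
    by apply/seteqP; split => w /=; rewrite in_itv/= andbT.
  exact: mf.
pose A (k : nat) := [set w | k%:R < f w].
have A0 : \bigcap_k A k = set0.
  apply/seteqP; split => // w Aw.
  have := Aw (Num.trunc (f w)).+1 I => /=.
  by rewrite /A/= ltNge ltW// truncnS_gt.
have : P \o A @ \oo --> P (\bigcap_k A k).
  apply: (@nonincreasing_cvg_mu _ _ _ P A) => //.
  - by rewrite (le_lt_trans (probability_le1 P (mA _)))// ltry.
  - by move=> i; exact: mA.
  - by rewrite A0; exact: measurable0.
  - move=> i j ij; apply/subsetPset => w; rewrite /A/=; apply: le_lt_trans.
    by rewrite ler_nat.
rewrite A0 measure0 => /fine_cvgP[_ /cvgrPdist_le/(_ eta eta0)[N _ /(_ N (leqnn N))]].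
rewrite /= sub0r normrN => H; exists N%:R; split => //.
exact: le_trans (ler_norm _) H.
Qed.

(** The product of the kernels at the normalised increments is bounded by the indicator of the event
    up to a small mean error, and its expectation by correlation from below. [D] is fixed before the
    process and the list, so it depends on alpha only. *)
Theorem SaS_small_ball {R : realType} (alpha : R) : 0 < alpha < 2 ->
  exists2 D : R, 0 < D &
  forall (d : measure_display) (Omega : measurableType d)
      (P : probability Omega R) (T : Type) (X : T -> {RV P >-> R})
      (rho : T -> T -> R) (L : seq (T * T * R)),
    SaS_process alpha X ->
    (forall s t, 0 <= rho s t) ->
    (forall s t (u : R),
      ('E_P[fun w => cos (u * (X t w - X s w))]
         = (expR (- (rho t s `^ alpha * `|u| `^ alpha)))%:E)%E) ->
    all (fun c : T * T * R => 0 < c.2) L ->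
    measurable [set w | all (fun c : T * T * R => `|X c.1.1 w - X c.1.2 w| <= c.2) L] /\
    expR (- \sum_(c <- L) small_ball_cost alpha D (rho c.1.1 c.1.2 / c.2)) <=
      fine (P [set w | all (fun c : T * T * R => `|X c.1.1 w - X c.1.2 w| <= c.2) L]).
Proof.
move=> alpha02; have [B [b [B0 b0 kernel]]] := @bohman_kernel R.
have [D D0 cost_le] := expR_cost_le _ _ _ alpha02 B0 b0.
exists D => // d Omega P T X rho L sasX rho0 charX Lpos.
set A := [set w | _].
pose m := size L.
pose cn (i : 'I_m) : T * T * R := tnth (in_tuple L) i.
have cn0 i : 0 < (cn i).2.
  move/(all_tnthP (t := in_tuple L)): Lpos; exact.
(* Both endpoints of every constraint get their own index, so each increment is a linear form in one
   stable vector, whatever repetitions occur. *)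
pose p (k : 'I_(m + m)) : T :=
  match fintype.split k with inl i => (cn i).1.1 | inr i => (cn i).1.2 end.
have [Q [_ Qchar Qpar]] := SaS_vector_exponent _ _ _ _ alpha02 (sasX _ p).
pose th (i : 'I_m) (k : 'I_(m + m)) : R :=
  ((k == lshift m i)%:R - (k == rshift m i)%:R) / (cn i).2.
have pl i : p (lshift m i) = (cn i).1.1 by rewrite /p (unsplitK (inl i)).
have pr i : p (rshift m i) = (cn i).1.2 by rewrite /p (unsplitK (inr i)).
pose xi (i : 'I_m) (w : Omega) : R := (X (cn i).1.1 w - X (cn i).1.2 w) / (cn i).2.
have thE i w : \sum_(k < m + m) th i k * X (p k) w = xi i w.
  transitivity ((\sum_(k < m + m) ((k == lshift m i)%:R * X (p k) w)
     - \sum_(k < m + m) ((k == rshift m i)%:R * X (p k) w)) / (cn i).2).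
    rewrite -sumrB mulr_suml; apply: eq_bigr => k _; rewrite /th; ring.
  rewrite (bigD1 (lshift m i))//= eqxx mul1r big1 ?addr0 => [|k /negbTE->]; last by rewrite mul0r.
  rewrite (bigD1 (rshift m i))//= eqxx mul1r big1 ?addr0 => [|k /negbTE->]; last by rewrite mul0r.
  by rewrite pl pr.
have QE i u : Q (fun k => u * th i k) =
    (rho (cn i).1.1 (cn i).1.2 / (cn i).2) `^ alpha * `|u| `^ alpha.
  have := Qchar (fun k => u * th i k).
  have -> : (fun w => cos (\sum_(k < m + m) u * th i k * X (p k) w)) =
      (fun w => cos (u / (cn i).2 * (X (cn i).1.1 w - X (cn i).1.2 w))).
    apply/funext => w; congr cos; under eq_bigr do rewrite -mulrA.
    by rewrite -mulr_sumr thE /xi; ring.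
  rewrite charX => -[] /expR_inj/oppr_inj <-.
  rewrite normrM normfV (gtr0_norm (cn0 i)) !powRM ?invr_ge0 ?(ltW (cn0 i))//; ring.
pose Y k := X (p k).
have xiE i : linear_form P _ Y (th i) = xi i by apply/funext => w; exact: thE.
have mxi i : measurable_fun setT (xi i) by rewrite -xiE; exact: measurable_linear_form.
have AE : A = \bigcap_(i in [set: 'I_m]) [set w | `|xi i w| <= 1].
  apply/seteqP; split => w.
    move=> /(all_tnthP (t := in_tuple L)) H i _ /=.
    by rewrite /xi normrM normfV (gtr0_norm (cn0 i)) ler_pdivrMr// mul1r; exact: H.
  move=> H; apply/(all_tnthP (t := in_tuple L)) => i.
  have /= := H i I.
  by rewrite /xi normrM normfV (gtr0_norm (cn0 i)) ler_pdivrMr// mul1r.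
have mA : measurable A.
  rewrite AE; apply: fin_bigcap_measurable => // i _.
  rewrite -[X in measurable X]setTI.
  have mn : measurable_fun setT (fun w => `|xi i w|).
    exact: (measurableT_comp (@normr_measurable R setT)).
  have -> : [set w | `|xi i w| <= 1] = (fun w => `|xi i w|) @^-1` `]-oo, 1].
    by apply/seteqP; split => w /=; rewrite in_itv.
  exact: mn.
split => //.
apply/ler_addgt0Pr => e e0.
have e20 : 0 < e / 2 by lra.
pose f w := \sum_(i < m) `|xi i w|.
have mf : measurable_fun setT f.
  by apply: measurable_sum => i; exact: (measurableT_comp (@normr_measurable R setT)).
(* The error [e] is halved: one half for the event that some increment may leave the range [r] of
   the kernel, one for the kernel's accuracy within it. *)
have [r [mr tail]] := exists_small_tail P _ _ mf e20.
have [n [c [u [c0 sc cB cb csmall]]]] := kernel (e / 2) r e20.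
pose phi (x : R) := \sum_k c k * cos (u k * x).
have phi1 x : `|phi x| <= 1.
  rewrite -sc; apply: le_trans (ler_norm_sum _ _ _) _; apply: ler_sum => k _.
  by rewrite normrM (ger0_norm (c0 k)) ler_piMr// cos_max.
have bphi i : bounded_measurable (fun w => phi (xi i w)).
  apply: bounded_measurable_sum => k; apply: bounded_measurableM.
    exact: bounded_measurable_cst.
  by apply: bounded_measurable_cos; apply: measurable_funM => //; exact: measurable_cst.
have bprod : bounded_measurable (fun w => \prod_(i < m) phi (xi i w)).
  exact: bounded_measurable_prod.
apply: le_trans (_ : \int[P]_w \prod_(i < m) phi (xi i w) <= _).
  have := Rintegral_prod_cosine_ge P _ Y Q Qchar Qpar _ _ th c u c0.
  under [X in _ <= X -> _]eq_Rintegral => w _ do under eq_bigr do rewrite xiE.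
  apply: le_trans.
  have -> : \sum_(c <- L) small_ball_cost alpha D (rho c.1.1 c.1.2 / c.2) =
      \sum_(i < m) small_ball_cost alpha D (rho (cn i).1.1 (cn i).1.2 / (cn i).2).
    by rewrite [LHS](big_tnth _ _ L).
  rewrite -sumrN expR_sum; apply: ler_prod => i _; rewrite expR_ge0/=.
  under eq_bigr do rewrite QE.
  by apply: cost_le => //; rewrite divr_ge0// ltW.
pose G := [set w | r < f w].
have bA := @bounded_measurable_indic R _ _ _ mA.
have bG : bounded_measurable (fun w => e / 2 + \1_G w : R).
  apply: bounded_measurableD; first exact: bounded_measurable_cst.
  exact: bounded_measurable_indic.
(* Off [A] and [G], some |xi i w| lies between 1 and [r], where |phi| <= e/2; the other factors are
   at most 1 in absolute value. *)
apply: le_trans (_ : \int[P]_w (\1_A w + (e / 2 + \1_G w)) <= _).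
  apply: Rintegral_le => //.
    exact: bounded_measurableD.
  move=> w.
  have prod1 (I : pred 'I_m) : `|\prod_(i < m | I i) phi (xi i w)| <= 1.
    rewrite normr_prod; apply: le_trans (_ : \prod_(i < m | I i) 1 <= _).
      by apply: ler_prod => i _; rewrite normr_ge0/=; exact: phi1.
    by rewrite big1.
  have [wA|wA] := pselect (A w).
    have -> : \1_A w = 1 :> R by rewrite indicE mem_set.
    apply: le_trans (ler_norm _) _; apply: le_trans (prod1 _) _.
    by rewrite lerDl addr_ge0 ?(ltW e20)// indicE.
  have -> : \1_A w = 0 :> R by rewrite indicE memNset.
  rewrite add0r indicE.
  have [wr|wr] := ltP r (f w).
    rewrite mem_set//.
    apply: le_trans (ler_norm _) _; apply: le_trans (prod1 _) _.
    by rewrite lerDr ltW.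
  rewrite memNset ?addr0; last by apply/negP; rewrite -leNgt.
  have [i xi1] : exists i, 1 < `|xi i w|.
    apply: contrapT => H; apply: wA; rewrite AE => i _ /=.
    by rewrite leNgt; apply/negP => xi1; apply: H; exists i.
  rewrite (bigD1 i)//=; apply: le_trans (ler_norm _) _; rewrite normrM.
  apply: le_trans (_ : `|phi (xi i w)| * 1 <= _); first by rewrite ler_wpM2l.
  rewrite mulr1; apply: csmall; rewrite (ltW xi1)/=; apply: le_trans wr.
  by rewrite /f (bigD1 i)//= lerDl sumr_ge0.
rewrite RintegralD//; [|exact: bounded_measurable_integrable..].
rewrite RintegralD//; last 2 first.
- exact/bounded_measurable_integrable/bounded_measurable_cst.
- exact/bounded_measurable_integrable/bounded_measurable_indic.
rewrite !Rintegral_indic_setT// Rintegral_cst//.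
have -> : fine (P setT) = 1 by exact: (congr1 fine (probability_setT P)).
move: tail; rewrite -/G; lra.
Qed.

(** * Chaining *)

Lemma SaS_scale_sym {R : realType} {d : measure_display} {Omega : measurableType d}
    (P : probability Omega R) (alpha : R) (T : Type) (X : T -> {RV P >-> R})
    (rho : T -> T -> R) : 0 < alpha -> (forall s t, 0 <= rho s t) ->
  (forall s t (u : R), ('E_P[fun w => cos (u * (X t w - X s w))]
     = (expR (- (rho t s `^ alpha * `|u| `^ alpha)))%:E)%E) ->
  forall s t, rho s t = rho t s.
Proof.
move=> alpha0 rho0 charX s t.
apply: (powR_injective alpha0); rewrite ?nnegrE//.
have := charX s t 1; have -> : (fun w => cos (1 * (X t w - X s w))) =
    (fun w => cos (1 * (X s w - X t w))).
  by apply/funext => w; rewrite -cosN -mulrN opprB.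
rewrite charX normr1 powR1 !mulr1 => -[] /expR_inj/oppr_inj.
by [].
Qed.

(** The parallelogram bound is applied to the forms of X(s) - X(t) and X(t) - X(u), whose sum is
    that of X(s) - X(u); the nonnegative term of their difference is dropped. *)
Lemma SaS_scale_quasi_triangle {R : realType} {d : measure_display}
    {Omega : measurableType d} (P : probability Omega R) (alpha : R) (T : Type)
    (X : T -> {RV P >-> R}) (rho : T -> T -> R) :
  0 < alpha < 2 -> SaS_process alpha X ->
  (forall s t (u : R), ('E_P[fun w => cos (u * (X t w - X s w))]
     = (expR (- (rho t s `^ alpha * `|u| `^ alpha)))%:E)%E) ->
  forall s t u, rho s u `^ alpha <= 2 * (rho s t `^ alpha + rho t u `^ alpha).
Proof.
move=> alpha02 sasX charX s t u.
pose p (i : 'I_3) : T := if i == 0 then s else if i == 1 then t else u.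
have [Q [Q0 Qchar Qpar]] := SaS_vector_exponent _ _ _ _ alpha02 (sasX _ p).
pose th (i j k : 'I_3) : R := (k == i)%:R - (k == j)%:R.
have QE i j : Q (th i j) = rho (p i) (p j) `^ alpha.
  have := Qchar (th i j).
  have -> : (fun w => cos (\sum_(k < 3) th i j k * X (p k) w)) =
      (fun w => cos (1 * (X (p i) w - X (p j) w))).
    apply/funext => w; congr cos; rewrite mul1r.
    under eq_bigr do rewrite mulrBl.
    rewrite sumrB (bigD1 i)//= eqxx mul1r big1 ?addr0 => [|k /negbTE->]; last by rewrite mul0r.
    by rewrite (bigD1 j)//= eqxx mul1r big1 ?addr0 => [|k /negbTE->]; last rewrite mul0r.
  by rewrite charX normr1 powR1 mulr1 => -[] /expR_inj/oppr_inj.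
have := Qpar (th 0 1) (th 1 2%:R).
have -> : (fun i => th 0 1 i + th 1 2%:R i) = th 0 2%:R.
  by apply/funext => i; rewrite /th; ring.
have := Q0 (fun i => th 0 1 i - th 1 2%:R i).
rewrite !QE /p/=; lra.
Qed.

Lemma powR_exprn {R : realType} (x p : R) (k : nat) : 0 <= x ->
  (x ^+ k) `^ p = (x `^ p) ^+ k.
Proof. by move=> x0; rewrite -powR_mulrn// powRAC powR_mulrn// powR_ge0. Qed.

Section chaining.
Context {R : realType} {T : Type} (rho : T -> T -> R) (alpha D : R).
Hypothesis alpha0 : 0 < alpha.
Hypothesis D0 : 0 < D.
Hypothesis rho_ge0 : forall s t, 0 <= rho s t.
Hypothesis rho_sym : forall s t, rho s t = rho t s.
Hypothesis rho_triangle : forall s t u,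
  rho s u `^ alpha <= 2 * (rho s t `^ alpha + rho t u `^ alpha).

Let cost := small_ball_cost alpha D.

(** Constraints are put on a deterministic path, so chaining is pure combinatorics and probability
    enters only through the total cost. *)
Definition satisfies (x : T -> R) (L : seq (T * T * R)) : bool :=
  all (fun c : T * T * R => `|x c.1.1 - x c.1.2| <= c.2) L.

Definition total_cost (L : seq (T * T * R)) : R :=
  \sum_(c <- L) cost (rho c.1.1 c.1.2 / c.2).

Definition positive_tolerances (L : seq (T * T * R)) : bool :=
  all (fun c : T * T * R => 0 < c.2) L.

Lemma cost_le_powR r : cost r <= D * r `^ alpha.
Proof. by rewrite ler_wpM2l ?(ltW D0)// ge_min lexx. Qed.

(** From 1 + ln 2 + (ln 4) / alpha + 2 j ln 2 <= (3 + 2 / alpha) (1 + j), using ln 2 <= 1 and ln 4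
    <= 2. *)
Definition coarse_constant : R := D * (3 + 2 / alpha).

Lemma coarse_constant_gt0 : 0 < coarse_constant.
Proof. by rewrite mulr_gt0// addr_gt0// divr_gt0. Qed.

(** A distance of order eps 2^j at tolerance eps / 2^j has ratio of order 4^j, so the logarithmic
    branch is linear in j. *)
Lemma coarse_link_cost s t eps (j : nat) : 0 < eps ->
  rho s t <= 2 * 4 `^ alpha^-1 * eps * 2 ^+ j ->
  cost (rho s t / (eps / 2 ^+ j)) <= coarse_constant * (1 + j%:R).
Proof.
move=> eps0 st.
have p0 : 0 < 2 ^+ j :> R by rewrite exprn_gt0.
have a0 : 0 < 4 `^ alpha^-1 :> R by rewrite powR_gt0.
have a1 : 1 <= 4 `^ alpha^-1 :> R.
  have e1 : 1 `^ alpha^-1 = 1 :> R by rewrite powR1.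
  rewrite -[leLHS]e1; apply: ge0_ler_powR; rewrite ?nnegrE ?invr_ge0 ?(ltW alpha0)//; lra.
set r := rho s t / _.
have rle : r <= 2 * 4 `^ alpha^-1 * (2 ^+ j * 2 ^+ j).
  rewrite /r ler_pdivrMr ?divr_gt0// (le_trans st)// le_eqVlt; apply/orP; left; apply/eqP.
  by field; rewrite expf_neq0.
have p1 : 1 <= 2 ^+ j :> R by rewrite exprn_ege1// ler1n.
have big1 : 1 <= 2 * 4 `^ alpha^-1 * (2 ^+ j * 2 ^+ j) :> R.
  by rewrite !mulr_ege1// ler1n.
have ln2 : ln 2 <= 1 :> R.
  by have := @le_ln1Dx R 1; rewrite -[1 + 1]/(2); apply; lra.
have ln4 : ln 4 <= 2 :> R.
  have -> : 4 = 2 * 2 :> R by lra.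
  by rewrite lnM ?posrE//; lra.
apply: le_trans (_ : D * (1 + ln (Num.max 1 r)) <= _).
  by rewrite ler_wpM2l ?(ltW D0)// ge_min lexx orbT.
rewrite /coarse_constant -mulrA ler_wpM2l ?(ltW D0)//.
have ia : 0 <= alpha^-1 by rewrite invr_ge0 ltW.
have lnr : ln (Num.max 1 r) <= ln 2 + alpha^-1 * ln 4 + (ln 2 *+ j + ln 2 *+ j).
  rewrite -ln_powR -lnXn// -!lnM ?posrE ?mulr_gt0//.
  rewrite ler_ln ?posrE ?mulr_gt0//; first by rewrite ge_max big1 rle.
  by rewrite lt_max ltr01.
have lj : ln 2 *+ j <= j%:R :> R.
  by rewrite -(mulr_natr (ln 2) j) ler_piMl.
have j0 : 0 <= j%:R :> R by [].
have : alpha^-1 * ln 4 <= 2 / alpha by rewrite mulrC ler_wpM2r.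
have : 0 <= 2 / alpha * j%:R by rewrite mulr_ge0// mulr_ge0.
nra.
Qed.

Variable Psi : R -> R.
Hypothesis nets : forall r, 0 < r ->
  exists (n : nat) (f : 'I_n -> T), n%:R <= Psi r /\ forall t, exists i, rho t (f i) <= r.

(** Centres of a net of [T] are replaced by nearby points of [U]; the quasi-triangle inequality
    turns two distances r into 4^(1/alpha) r. *)
Lemma thin_net (N : nat) (F : 'I_N -> T) (U : {set 'I_N}) (r : R) : 0 < r -> U != finset.set0 ->
  exists V : {set 'I_N}, [/\ V \subset U, V != finset.set0, #|V|%:R <= Psi r &
    forall i, i \in U -> exists2 j, j \in V & rho (F i) (F j) <= 4 `^ alpha^-1 * r].
Proof.
move=> r0 /finset.set0Pn[i0 i0U].
have [n [f [nPsi fnet]]] := nets _ r0.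
(* A centre with no point of [U] nearby goes to [i0], which keeps [V] inside [U] without raising the
   count. *)
pose g k := odflt i0 [pick i in U | rho (F i) (f k) <= r].
exists (finset.imset g (mem [set: 'I_n]%SET)); split.
- apply/fintype.subsetP => _ /finset.imsetP[k _ ->].
  by rewrite /g; case: pickP => [i /andP[]|].
- have [k _] := fnet (F i0).
  by apply/finset.set0Pn; exists (g k); apply/finset.imsetP; exists k.
- apply: le_trans nPsi; rewrite ler_nat.
  by apply: leq_trans (finset.leq_imset_card _ _) _; rewrite finset.cardsT card_ord.
- move=> i iU; have [k ik] := fnet (F i).
  exists (g k); first by apply/finset.imsetP; exists k.
  have gk : rho (F (g k)) (f k) <= r.
    rewrite /g; case: pickP => [? /andP[]//|/(_ i)].
    by rewrite iU ik.
  have h : rho (F i) (F (g k)) `^ alpha <= 4 * r `^ alpha.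
    apply: le_trans (rho_triangle _ (f k) _) _.
    have ml x : 0 <= x -> x <= r -> x `^ alpha <= r `^ alpha.
      by move=> x0 xr; apply: ge0_ler_powR; rewrite ?nnegrE ?(ltW alpha0) ?(ltW r0).
    have := ml _ (rho_ge0 _ _) ik; have := ml _ (rho_ge0 _ _) gk.
    rewrite (rho_sym (f k)); lra.
  have E x : 0 <= x -> x = (x `^ alpha) `^ alpha^-1.
    by move=> x0; rewrite -powRrM divff ?gt_eqF// powRr1.
  rewrite (E _ (rho_ge0 (F i) (F (g k)))) [in leRHS](E r (ltW r0)) -powRM ?powR_ge0//.
  by apply: ge0_ler_powR; rewrite ?nnegrE ?invr_ge0 ?mulr_ge0 ?powR_ge0 ?(ltW alpha0).
Qed.

(* Abel summation: a point is linked only at the level where it leaves the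
   decreasing sequence of nets, so that level [j] contributes its cardinality
   once and not [j] times. *)
Lemma coarse_chain (N : nat) (F : 'I_N -> T) (eps : R) (k j : nat) (U : {set 'I_N}) :
  0 < eps -> U != finset.set0 ->
  (forall s t, rho s t <= eps * 2 ^+ (j + k).+1) ->
  exists (L : seq (T * T * R)) (i0 : 'I_N),
    [/\ positive_tolerances L,
        total_cost L <= coarse_constant *
          ((1 + j%:R) * #|U|%:R + \sum_(i < k) Psi (eps * 2 ^+ (j + i).+1)) &
        forall x, satisfies x L -> forall i, i \in U ->
          `|x (F i) - x (F i0)| <= 2 * (eps / 2 ^+ j)].
Proof.
move=> eps0.
have chain_cost (W : {set 'I_N}) (g : 'I_N -> 'I_N) (l : nat) :
    (forall i, i \in W -> rho (F i) (F (g i)) <= 2 * 4 `^ alpha^-1 * eps * 2 ^+ l) ->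
    total_cost [seq (F i, F (g i), eps / 2 ^+ l) | i <- fintype.enum W] <=
      coarse_constant * (1 + l%:R) * #|W|%:R.
  move=> gW; rewrite /total_cost big_map big_enum/= mulr_natr -sumr_const.
  by apply: ler_sum => i iW; apply: coarse_link_cost => //; exact: gW.
have a1 : 1 <= 4 `^ alpha^-1 :> R.
  have e1 : 1 `^ alpha^-1 = 1 :> R by rewrite powR1.
  rewrite -[leLHS]e1; apply: ge0_ler_powR; rewrite ?nnegrE ?invr_ge0 ?(ltW alpha0)//; lra.
elim: k j U => [|k IH] j U U0 diamT.
  (* At the last level the diameter bound allows every point of [U] to be linked to one point. *)
  have /finset.set0Pn[i0 i0U] := U0.
  have p0 : 0 < 2 ^+ j :> R by rewrite exprn_gt0.
  have e0 : 0 < eps / 2 ^+ j by rewrite divr_gt0.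
  exists [seq (F i, F i0, eps / 2 ^+ j) | i <- fintype.enum U], i0; split.
  - by rewrite /positive_tolerances all_map; apply/allP => i _ /=.
  - rewrite big_ord0 addr0 mulrA; apply: (chain_cost U (fun=> i0)) => i _.
    apply: le_trans (diamT _ _) _.
    rewrite addn0 exprS; have : 0 < eps * 2 ^+ j by rewrite mulr_gt0.
    nra.
  - move=> x; rewrite /satisfies all_map => /allP H i iU.
    have := H i; rewrite mem_enum iU => /(_ isT)/=; lra.
have r0 : 0 < eps * 2 ^+ j.+1 by rewrite mulr_gt0// exprn_gt0.
have [V [VU V0 VPsi VF]] := thin_net _ F U _ r0 U0.
have [|L' [i0 [L'0 L'cost L'sat]]] := IH j.+1 V V0.
  by move=> s t; rewrite addSnnS; exact: diamT.
pose g i := odflt i0 [pick v in V | rho (F i) (F v) <= 4 `^ alpha^-1 * (eps * 2 ^+ j.+1)].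
have gP i : i \in U -> g i \in V /\ rho (F i) (F (g i)) <= 4 `^ alpha^-1 * (eps * 2 ^+ j.+1).
  move=> iU; have [v vV iv] := VF _ iU; rewrite /g.
  by case: pickP => [? /andP[]//|/(_ v)]; rewrite vV iv.
have p0 : 0 < 2 ^+ j :> R by rewrite exprn_gt0.
have e0 : 0 < eps / 2 ^+ j by rewrite divr_gt0.
(* The tolerance eps / 2^j plus the next level's bound 2 eps / 2^(j+1) gives 2 eps / 2^j again. *)
exists ([seq (F i, F (g i), eps / 2 ^+ j) | i <- fintype.enum (U :\: V)%SET] ++ L'), i0; split.
- rewrite /positive_tolerances all_cat [X in _ && X]L'0 andbT all_map.
  by apply/allP => i _ /=.
- rewrite /total_cost big_cat/=.
  apply: le_trans (lerD (chain_cost (U :\: V)%SET g j _) L'cost) _.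
    move=> i /finset.setDP[iU _]; have [_] := gP _ iU.
    move=> /le_trans; apply; rewrite exprS le_eqVlt; apply/orP; left; apply/eqP; ring.
  (* (1 + j)(|U| - |V|) + (2 + j)|V| = (1 + j)|U| + |V|, and |V| is bounded by the first term of the
     sum over Psi. *)
  have cV : (#|V| <= #|U|)%N by exact: subset_leq_card.
  rewrite finset.cardsD (finset.setIidPr VU) natrB//.
  rewrite -mulrA -mulrDr ler_wpM2l ?(ltW coarse_constant_gt0)//.
  rewrite big_ord_recl/= addn0.
  under [X in _ <= _ + (_ + X)]eq_bigr do rewrite /bump/= add1n -addSnnS.
  rewrite -(natr1 j); lra.
- move=> x; rewrite /satisfies all_cat all_map => /andP[/allP H L'x] i iU.
  have eS : eps / 2 ^+ j.+1 = (eps / 2 ^+ j) / 2 by rewrite exprS; field; rewrite expf_neq0.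
  have [iV|iV] := boolP (i \in V).
    by have := L'sat x L'x i iV; rewrite eS; lra.
  have := H i; rewrite mem_enum finset.in_setD iV iU => /(_ isT)/= h1.
  have [giV _] := gP _ iU; have := L'sat x L'x _ giV.
  rewrite eS => h2.
  have := ler_distD (x (F (g i))) (x (F i)) (x (F i0)); lra.
Qed.

(** Each level links its net to the previous one. The tolerances sum to at most eps, while scale
    over tolerance at level l is (2q)^(-l) / (1 - q). *)
Lemma fine_chain (eps q B : R) (N : nat) (F : 'I_N -> T) (L0 : seq (T * T * R)) (x0 : T)
    (k : nat) : 0 < eps -> 0 < q < 1 ->
  (forall t, exists i, rho t (F i) <= eps) ->
  positive_tolerances L0 ->
  (forall x, satisfies x L0 -> forall i, `|x (F i) - x x0| <= B) ->
  exists (n : nat) (f : 'I_n -> T) (L : seq (T * T * R)),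
    [/\ positive_tolerances L,
      total_cost L <= total_cost L0 +
        D * \sum_(l < k) Psi (eps / 2 ^+ l.+1) * ((2 ^+ l)^-1 / ((1 - q) * q ^+ l)) `^ alpha,
      (forall t, exists i, rho t (f i) <= eps / 2 ^+ k) &
      forall x, satisfies x L -> forall i,
        `|x (f i) - x x0| <= B + \sum_(l < k) (1 - q) * q ^+ l * eps].
Proof.
move=> eps0 /andP[q0 q1] Fnet L0pos L0sat; elim: k => [|k IH].
  exists N, F, L0; split => //.
  - by rewrite big_ord0 mulr0 addr0.
  - by move=> t; have [i it] := Fnet t; exists i; rewrite expr0 divr1.
  - by move=> x xL i; rewrite big_ord0 addr0; exact: L0sat.
have [n [f [L [Lpos Lcost fnet Lsat]]]] := IH.
have r0 : 0 < eps / 2 ^+ k.+1 by rewrite divr_gt0// exprn_gt0.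
have [n' [f' [n'Psi f'net]]] := nets _ r0.
have [g gP] := choice (fun i => fnet (f' i)).
set a := (1 - q) * q ^+ k * eps.
have q10 : 0 < 1 - q by lra.
have a0 : 0 < a by rewrite /a mulr_gt0// mulr_gt0// exprn_gt0.
exists n', f', ([seq (f' i, f (g i), a) | i <- fintype.enum 'I_n'] ++ L); split => //.
- rewrite /positive_tolerances all_cat [X in _ && X]Lpos andbT all_map.
  by apply/allP => i _ /=.
- rewrite /total_cost big_cat/= big_map big_ord_recr/= mulrDr [in leRHS]addrA addrC.
  apply: lerD => //.
  set c := (_ / _) `^ alpha.
  apply: le_trans (_ : n'%:R * (D * c) <= _); last first.
    by rewrite mulrCA ler_wpM2l ?(ltW D0)// ler_wpM2r ?powR_ge0.
  rewrite mulr_natl -[in leRHS](card_ord n') -sumr_const big_enum/=; apply: ler_sum => i _.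
  apply: le_trans (cost_le_powR _) _; rewrite ler_wpM2l ?(ltW D0)//.
  apply: ge0_ler_powR; rewrite ?nnegrE ?(ltW alpha0)//.
  + by rewrite divr_ge0// ltW.
  + by rewrite divr_ge0 ?invr_ge0 ?mulr_ge0 ?exprn_ge0 ?(ltW q10) ?(ltW q0).
  rewrite ler_pdivrMr// (le_trans (gP i))// /a le_eqVlt; apply/orP; left; apply/eqP.
  by field; rewrite !expf_neq0 ?gt_eqF.
- move=> x; rewrite /satisfies all_cat all_map => /andP[/allP H Lx] i.
  have := H i; rewrite mem_enum => /(_ isT)/= h1.
  have h2 := Lsat x Lx (g i).
  rewrite big_ord_recr/= -/a.
  have := ler_distD (x (f (g i))) (x (f' i)) (x x0); lra.
Qed.

Lemma sum_geometric_le (z : R) (k : nat) : 0 <= z < 1 -> \sum_(l < k) z ^+ l <= (1 - z)^-1.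
Proof.
move=> /andP[z0 z1]; rewrite -[leRHS]mul1r ler_pdivlMr ?subr_gt0//.
have := subrX1 z k; have := exprn_ge0 k z0; lra.
Qed.

(** The radius 4 eps is 2 eps from the coarse chain, eps from the fine one and eps from a last link.
    The cost bound is free of [m], which permits a passage to countably many points. *)
Lemma finite_chain (eps q C2 : R) (J m : nat) (e : nat -> T) :
  0 < eps -> 0 < q < 1 -> 0 < C2 -> C2 * (2 * q)^-1 `^ alpha < 1 ->
  (forall r, 0 < r -> Psi (r / 2) <= C2 * Psi r) ->
  (forall s t, rho s t <= eps * 2 ^+ J.+1) ->
  exists (L : seq (T * T * R)) (x0 : T),
    [/\ positive_tolerances L,
      total_cost L <= (coarse_constant +
          D * C2 * (1 - q)^-1 `^ alpha / (1 - C2 * (2 * q)^-1 `^ alpha) + 1) *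
        \sum_(i < J.+1) Psi (eps * 2 ^+ i) &
      forall x, satisfies x L -> forall i, (i < m)%N -> `|x (e i) - x x0| <= 4 * eps].
Proof.
move=> eps0 q01 C20 th1 Psi2 diamT; have /andP[q0 q1] := q01.
have q10 : 0 < 1 - q by lra.
set th := C2 * _ in th1 *.
have th0 : 0 <= th by rewrite mulr_ge0 ?powR_ge0 ?(ltW C20).
have Psi1 r : 0 < r -> 1 <= Psi r.
  move=> r0; have [n [f [nPsi fnet]]] := nets _ r0.
  have [i _] := fnet (e 0%N); apply: le_trans nPsi.
  by rewrite ler1n (leq_ltn_trans _ (ltn_ord i)).
have [N [F [NPsi Fnet]]] := nets _ eps0.
have [i1 _] := Fnet (e 0%N).
have U0 : [set: 'I_N]%SET != finset.set0 by apply/finset.set0Pn; exists i1; rewrite finset.in_setT.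
have [|L0 [i0 [L0pos L0cost L0sat]]] := coarse_chain N F eps J 0 _ eps0 U0.
  by move=> s t; rewrite add0n; exact: diamT.
have {}L0sat x : satisfies x L0 -> forall i, `|x (F i) - x (F i0)| <= 2 * eps.
  by move=> /L0sat H i; have := H i; rewrite finset.in_setT expr0 divr1; apply.
(* The depth depends on [m]: the [m] last links then cost at most 1 <= Psi eps altogether, whence
   the summand 1 in the constant. *)
have [k kP] : exists k : nat, m%:R * (D * (2 ^+ k)^-1 `^ alpha) <= 1.
  pose z := 2^-1 `^ alpha : R.
  have z0 : 0 <= z by exact: powR_ge0.
  have z1 : `|z| < 1.
    rewrite ger0_norm//; have e1 : 1 `^ alpha = 1 :> R by rewrite powR1.
    by rewrite -[ltRHS]e1; apply: gt0_ltr_powR; rewrite ?nnegrE// invf_lt1// ltr1n.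
  have w0 : 0 < (m%:R * D + 1)^-1 by rewrite invr_gt0 ltr_wpDl// mulr_ge0// ltW.
  have /cvgrPdist_le/(_ _ w0)[k _ /(_ k (leqnn k))] := cvg_expr z1.
  rewrite /= sub0r normrN ger0_norm ?exprn_ge0// => kP; exists k.
  have -> : (2 ^+ k)^-1 `^ alpha = z ^+ k.
    by rewrite -exprVn powR_exprn.
  rewrite mulrA; apply: le_trans (_ : (m%:R * D + 1) * z ^+ k <= _).
    by rewrite ler_wpM2r ?exprn_ge0// lerDl.
  by rewrite mulrC -ler_pdivlMr ?div1r// -invr_gt0.
have [n [f [L [Lpos Lcost fnet Lsat]]]] :=
  fine_chain eps q (2 * eps) N F L0 (F i0) k eps0 q01 Fnet L0pos L0sat.
have [g gP] := choice (fun i : 'I_m => fnet (e i)).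
exists ([seq (e i, f (g i), eps) | i : 'I_m <- fintype.enum 'I_m] ++ L), (F i0); split.
- rewrite /positive_tolerances all_cat [X in _ && X]Lpos andbT all_map.
  by apply/allP => i _ /=.
- have Psi0 : 1 <= Psi eps by exact: Psi1.
  set S := \sum_(i < J.+1) _.
  have SE : S = Psi eps + \sum_(i < J) Psi (eps * 2 ^+ i.+1).
    by rewrite /S big_ord_recl expr0 mulr1.
  have PS : Psi eps <= S.
    rewrite SE lerDl sumr_ge0// => i _; apply: le_trans (Psi1 _ _) => //.
    by rewrite mulr_gt0// exprn_gt0.
  have costm : \sum_(c <- [seq (e i, f (g i), eps) | i : 'I_m <- fintype.enum 'I_m])
      cost (rho c.1.1 c.1.2 / c.2) <= S.
    apply: le_trans PS; apply: le_trans Psi0; apply: le_trans kP.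
    rewrite big_map mulr_natl -[in leRHS](card_ord m) -sumr_const big_enum/=.
    apply: ler_sum => i _.
    apply: le_trans (cost_le_powR _) _; rewrite ler_wpM2l ?(ltW D0)//.
    apply: ge0_ler_powR; rewrite ?nnegrE ?(ltW alpha0)//.
      by rewrite divr_ge0// ltW.
    by rewrite ler_pdivrMr// mulrC; exact: gP.
  have cost0 : total_cost L0 <= coarse_constant * S.
    apply: le_trans L0cost _; rewrite ler_wpM2l ?(ltW coarse_constant_gt0)// SE.
    rewrite addr0 mul1r finset.cardsT card_ord.
    by apply: lerD => //; apply: ler_sum => i _; rewrite add0n.
  have PsiX l : Psi (eps / 2 ^+ l) <= C2 ^+ l * Psi eps.
    elim: l => [|l IH]; first by rewrite !expr0 divr1 mul1r.
    have -> : eps / 2 ^+ l.+1 = (eps / 2 ^+ l) / 2.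
      by rewrite exprS; field; rewrite expf_neq0.
    apply: le_trans (Psi2 _ _) _; first by rewrite divr_gt0// exprn_gt0.
    by rewrite exprS -mulrA ler_wpM2l// ltW.
  (* Doubling contributes C2^(l+1) and the cost (2q)^(-alpha l): a geometric series of ratio [th] <
     1, bounded uniformly in [k]. *)
  have costk : \sum_(l < k) Psi (eps / 2 ^+ l.+1) * ((2 ^+ l)^-1 / ((1 - q) * q ^+ l)) `^ alpha
      <= C2 * (1 - q)^-1 `^ alpha / (1 - th) * S.
    apply: le_trans (_ : \sum_(l < k) (C2 * (1 - q)^-1 `^ alpha * Psi eps) * th ^+ l <= _).
      apply: ler_sum => l _.
      have -> : ((2 ^+ l)^-1 / ((1 - q) * q ^+ l)) `^ alpha =
          (1 - q)^-1 `^ alpha * ((2 * q)^-1 `^ alpha) ^+ l.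
        have -> : (2 ^+ l)^-1 / ((1 - q) * q ^+ l) = (1 - q)^-1 * (2 * q)^-1 ^+ l.
          rewrite exprVn exprMn; field.
          by rewrite !expf_neq0 ?gt_eqF.
        have i0' : 0 <= (2 * q)^-1 by rewrite invr_ge0 mulr_ge0// ltW.
        rewrite powRM ?invr_ge0 ?(ltW q10) ?exprn_ge0//.
        by rewrite powR_exprn.
      apply: le_trans (ler_wpM2r _ (PsiX l.+1)) _.
        by rewrite mulr_ge0 ?exprn_ge0 ?powR_ge0.
      rewrite /th exprMn exprS le_eqVlt; apply/orP; left; apply/eqP; ring.
    rewrite -mulr_sumr.
    have := sum_geometric_le th k; rewrite th0 th1 => /(_ isT) geo.
    have cc0 : 0 <= C2 * (1 - q)^-1 `^ alpha by rewrite mulr_ge0 ?powR_ge0// ltW.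
    rewrite [leRHS]mulrAC; apply: ler_pM => //.
    + by rewrite mulr_ge0//; lra.
    + by apply: sumr_ge0 => l _; rewrite exprn_ge0.
    by rewrite ler_wpM2l.
  rewrite /total_cost big_cat/= -/(total_cost L).
  have := ler_wpM2l (ltW D0) costk.
  have -> : D * (C2 * (1 - q)^-1 `^ alpha / (1 - th) * S) =
     (D * C2 * (1 - q)^-1 `^ alpha / (1 - th)) * S by ring.
  rewrite !mulrDl mul1r; lra.
- move=> x; rewrite /satisfies all_cat all_map => /andP[/allP H Lx] i im.
  have := H (Ordinal im); rewrite mem_enum => /(_ isT)/= h1.
  have h2 := Lsat x Lx (g (Ordinal im)).
  have : \sum_(l < k) (1 - q) * q ^+ l * eps <= eps.
    rewrite -mulr_suml -mulr_sumr ler_piMl ?(ltW eps0)//.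
    have := sum_geometric_le q k; rewrite (ltW q0) q1 => /(_ isT).
    by rewrite -[_^-1]div1r ler_pdivlMr// mulrC.
  have := ler_distD (x (f (g (Ordinal im)))) (x (e i)) (x (F i0)); lra.
Qed.

End chaining.

(** * The entropy integral *)

(** An infimum of natural numbers is a minimum; total boundedness supplies a candidate. *)
Lemma covering_number_attained {R : realType} {T : Type} (rho : T -> T -> R) (r b : R) :
  totally_bounded rho -> 0 < r -> (covering_number rho r <= b%:E)%E ->
  exists (n : nat) (f : 'I_n -> T), n%:R <= b /\ forall t, exists i, rho t (f i) <= r.
Proof.
move=> tb r0 Nb.
pose net (n : nat) := `[< exists f : 'I_n -> T, forall t, exists i, rho t (f i) <= r >].
have exnet : exists n, net n.
  by have [n [f fnet]] := tb _ r0; exists n; apply/asboolP; exists f.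
case: (ex_minnP exnet) => n /asboolP[f fnet] nmin.
exists n, f; split => //; rewrite -lee_fin; apply: le_trans Nb.
apply: le_ereal_inf_tmp => _ [k kf <-]; rewrite lee_fin ler_nat.
by apply: nmin; apply/asboolP.
Qed.

Section entropy_integral.
Context {R : realType} (Psi : R -> R) (C2 : R).
Hypothesis C20 : 0 < C2.
Hypothesis Psi_ge1 : forall r, 0 < r -> 1 <= Psi r.
Hypothesis Psi_noninc : {in `]0, +oo[ &, {homo Psi : x y /~ x <= y}}.
Hypothesis Psi_cont : {in `]0, +oo[, continuous Psi}.
Hypothesis Psi_doubling : forall r, 0 < r -> Psi (r / 2) <= C2 * Psi r.

Let mu := @lebesgue_measure R.

Lemma integrable_entropy (a b : R) : 0 < a ->
  mu.-integrable `[a, b]%classic (EFin \o (fun u => Psi u / u)).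
Proof.
move=> a0; apply: continuous_compact_integrable; first exact: segment_compact.
apply: continuous_in_subspaceT => x; rewrite inE/= in_itv/= => /andP[ax _].
have x0 : 0 < x by exact: lt_le_trans ax.
apply: cvgM; first by apply: Psi_cont; rewrite in_itv/= x0.
by apply: cvgV; [rewrite gt_eqF|exact: cvg_id].
Qed.

Lemma entropy_integral_ge0 (a b : R) : 0 < a -> 0 <= \int[mu]_(u in `[a, b]) (Psi u / u).
Proof.
move=> a0; apply: Rintegral_ge0 => x /=; rewrite in_itv/= => /andP[ax _].
have x0 : 0 < x by exact: lt_le_trans ax.
by rewrite divr_ge0 ?(ltW x0)// (le_trans _ (Psi_ge1 _ x0)).
Qed.

(** On [a, 2a] the integrand is at least Psi(2a) / (2a), and doubling gives Psi(2a) >= Psi(a) /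
    C2. *)
Lemma entropy_integral_split (a b : R) : 0 < a -> 2 * a <= b ->
  Psi a / (2 * C2) + \int[mu]_(u in `[2 * a, b]) (Psi u / u) <=
  \int[mu]_(u in `[a, b]) (Psi u / u).
Proof.
move=> a0 ab; have a20 : 0 < 2 * a by rewrite mulr_gt0.
have split := @Rintegral_itvB R (fun u => Psi u / u) (BLeft a) (BRight b) (2 * a)
  (integrable_entropy a b a0).
have {}split := split _ _.
rewrite -(@Rintegral_itv_obnd_cbnd _ (2 * a)); last first.
  apply: integrableS (integrable_entropy (2 * a) b a20) => //.
  by apply: subset_itvr; rewrite bnd_simp.
rewrite -split ?bnd_simp//; last by lra.
rewrite addrC -lerBrDl opprB addrCA subrr addr0.
have -> : Psi a / (2 * C2) = Psi a / (2 * C2 * a) * a by field; rewrite !gt_eqF.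
apply: le_trans (_ : \int[mu]_(u in `[a, 2 * a]) (Psi (2 * a) / (2 * a)) <= _); last first.
  apply: le_Rintegral => //.
  - apply: continuous_compact_integrable; first exact: segment_compact.
    by apply: continuous_subspaceT => x; exact: cvg_cst.
  - exact: integrable_entropy.
  move=> u /=; rewrite in_itv/= => /andP[au u2a].
  have u0 : 0 < u by exact: lt_le_trans au.
  apply: ler_pM.
  - by rewrite (le_trans _ (Psi_ge1 _ a20)).
  - by rewrite invr_ge0 ltW.
  - by apply: Psi_noninc; rewrite // in_itv/= ?a20 ?u0.
  - by rewrite lef_pV2.
rewrite Rintegral_cst// [X in fine X]lebesgue_measure_itv/= lte_fin.
have -> : a < 2 * a by lra.
rewrite /= (_ : 2 * a - a = a); last by ring.
rewrite ler_wpM2r ?(ltW a0)//.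
have := Psi_doubling _ a20; have -> : 2 * a / 2 = a by lra.
move=> h; rewrite ler_pdivrMr ?mulr_gt0//.
have -> : Psi (2 * a) / (2 * a) * (2 * C2 * a) = C2 * Psi (2 * a) by field; rewrite gt_eqF.
exact: h.
Qed.

Lemma sum_le_entropy_integral (J : nat) (a b : R) : 0 < a -> a * 2 ^+ J <= b ->
  \sum_(i < J) Psi (a * 2 ^+ i) <= 2 * C2 * \int[mu]_(u in `[a, b]) (Psi u / u).
Proof.
elim: J a => [|J IH] a a0 ab.
  by rewrite big_ord0 mulr_ge0 ?entropy_integral_ge0// mulr_ge0// ltW.
have a20 : 0 < 2 * a by rewrite mulr_gt0.
have ab' : 2 * a * 2 ^+ J <= b by rewrite (le_trans _ ab)// exprS; lra.
have a2b : 2 * a <= b.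
  by rewrite (le_trans _ ab')// ler_peMr ?(ltW a20)// exprn_ege1// ler1n.
have := IH _ a20 ab'; rewrite big_ord_recl expr0 mulr1.
under [X in _ -> _ + X <= _]eq_bigr => i _.
  rewrite lift0 exprS mulrA (mulrC a).
  over.
have := entropy_integral_split _ _ a0 a2b.
move=> /(ler_wpM2l (_ : 0 <= 2 * C2)) => /(_ _); rewrite mulrDr.
have -> : 2 * C2 * (Psi a / (2 * C2)) = Psi a by field; rewrite gt_eqF.
by move=> H1 H2; apply: le_trans (H1 _); [rewrite lerD2l|rewrite mulr_ge0// ltW].
Qed.

Lemma sum_le_Psi_tilde (sigma e : R) : 0 < e ->
  exists2 J : nat, sigma <= e * 2 ^+ J.+1 &
    \sum_(i < J.+1) Psi (e * 2 ^+ i) <= (4 * C2 + 1) * Psi_tilde Psi sigma e.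
Proof.
move=> e0; rewrite /Psi_tilde e0/=; case: leP => [es|es]; last first.
  exists 0%N; first by rewrite expr1; lra.
  rewrite big_ord1 expr0 mulr1; have := Psi_ge1 _ e0 => P1.
  have : 0 <= C2 * Psi e by rewrite mulr_ge0 ?(ltW C20)//; lra.
  lra.
have exJ : exists n, e * 2 ^+ n <= sigma by exists 0%N; rewrite expr0; lra.
have [n /= nJ|J eJ Jmax] := @ex_maxnP (fun n => e * 2 ^+ n <= sigma) (Num.trunc (sigma / e)) exJ.
  have n2 : n%:R <= sigma / e.
    rewrite ler_pdivlMr// mulrC (le_trans _ nJ)// ler_pM2l// -natrX ler_nat.
    by rewrite ltnW// ltn_expl.
  by rewrite truncn_ge_nat// (le_trans _ n2).
exists J.
  by rewrite leNgt; apply/negP => /ltW /Jmax; rewrite ltnn.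
(* The integral covers only the terms below [J]. The last one is bounded by its predecessor, which
   exists because e <= sigma / 2; this doubles 2 C2 to 4 C2. *)
have J0 : (0 < J)%N by apply: Jmax; rewrite expr1; lra.
have := sum_le_entropy_integral J e sigma e0 eJ.
set I := \int[mu]_(u in _) _ => SI.
have I0 : 0 <= I by exact: entropy_integral_ge0.
have S0 i : 0 <= Psi (e * 2 ^+ i).
  by rewrite (le_trans _ (Psi_ge1 _ _))// mulr_gt0// exprn_gt0.
have last_le : Psi (e * 2 ^+ J) <= \sum_(i < J) Psi (e * 2 ^+ i).
  rewrite -(prednK J0) big_ord_recr/=; apply: le_trans (_ : Psi (e * 2 ^+ J.-1) <= _).
    apply: Psi_noninc; rewrite ?in_itv/= ?andbT ?mulr_gt0 ?exprn_gt0//.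
    by rewrite ler_pM2l// ler_eXn2l// ltr1n.
  by rewrite lerDr sumr_ge0.
rewrite big_ord_recr/=.
have : 0 <= C2 * I by rewrite mulr_ge0// ltW.
lra.
Qed.

End entropy_integral.

(** * Separability and the conclusion *)

Lemma countable_subset_range {T : Type} (S : set T) (t0 : T) : countable S ->
  exists e : nat -> T, S `<=` range e.
Proof.
move=> /countable_injP[f finj].
have ex n : exists t, (exists2 s, S s & f s = n) -> S t /\ f t = n.
  case: (pselect (exists2 s, S s & f s = n)) => [[s Ss fs]|no]; last by exists t0.
  by exists s.
have [e eP] := choice ex.
exists e => s Ss; exists (f s) => //.
by have [Se fe] := eP (f s) (ex_intro2 _ _ s Ss erefl); apply: finj; rewrite ?inE.
Qed.

(** The event over all of [T] may fail to be measurable, hence the subset [A]. Events on the first m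
    points of an enumeration covering the separating set decrease, so the bound [p] passes to their
    intersection; off the null set, separability extends it to [T]. *)
Lemma separable_small_oscillation {R : realType} {d : measure_display}
    {Omega : measurableType d} (P : probability Omega R) (T : Type) (t0 : T)
    (X : T -> {RV P >-> R}) (rho : T -> T -> R) (a : R) (p : \bar R) :
  separable_process rho X ->
  (forall (e : nat -> T) (m : nat), exists E : set Omega,
    [/\ measurable E, (p <= P E)%E &
      forall w, E w -> forall i j, (i < m)%N -> (j < m)%N ->
        `|X (e i) w - X (e j) w| <= a]) ->
  exists2 A : set Omega, measurable A &
    A `<=` [set w | forall s t, `|X s w - X t w| <= a] /\ (p <= P A)%E.
Proof.
move=> [S [N [cS mN N0 sep]]] fin.
have PN : (P N <= 0)%E by move: N0 => ->.
have [e Se] := countable_subset_range _ t0 cS.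
pose B (i j : nat) := [set w | `|X (e i) w - X (e j) w| <= a].
have mB i j : measurable (B i j).
  rewrite -[X in measurable X]setTI.
  have mn : measurable_fun setT (fun w => `|X (e i) w - X (e j) w|).
    by apply: (measurableT_comp (@normr_measurable R setT)); exact: measurable_funB.
  have -> : B i j = (fun w => `|X (e i) w - X (e j) w|) @^-1` `]-oo, a].
    by apply/seteqP; split => w /=; rewrite in_itv.
  exact: mn.
pose E (m : nat) := \bigcap_(q in [set: 'I_m * 'I_m]) B q.1 q.2.
have mE m : measurable (E m) by apply: fin_bigcap_measurable => // q _; exact: mB.
have mcap : measurable (\bigcap_m E m) by exact: bigcapT_measurable.
have PE m : (p <= P (E m))%E.
  have [F [mF pF FB]] := fin e m; apply: le_trans pF _.
  apply: le_measure; rewrite ?inE// => w Fw [i j] _ /=.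
  by apply: FB => //; exact: ltn_ord.
have Pcap : (p <= P (\bigcap_m E m))%E.
  have : P \o E @ \oo --> P (\bigcap_m E m).
    apply: (@nonincreasing_cvg_mu _ _ _ P E) => //.
      by rewrite (le_lt_trans (probability_le1 P (mE _)))// ltry.
    move=> i j ij; apply/subsetPset => w Ew [k l] _ /=.
    exact: Ew (widen_ord ij k, widen_ord ij l) I.
  by apply: cvge_ge; exact: nearW.
exists (\bigcap_m E m `\` N); first exact: measurableD.
split.
  move=> w [Ew Nw] s t /=; apply/ler_addgt0Pr => h h0.
  have h20 : 0 < h / 2 by lra.
  have [s' /Se[i _ <-] [_ si]] := sep w Nw s _ h20.
  have [t' /Se[j _ <-] [_ tj]] := sep w Nw t _ h20.
  have im : (i < (maxn i j).+1)%N by rewrite ltnS leq_maxl.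
  have jm : (j < (maxn i j).+1)%N by rewrite ltnS leq_maxr.
  have := Ew (maxn i j).+1 I (Ordinal im, Ordinal jm) I; rewrite /B/= => ij.
  have := ler_distD (X (e i) w) (X s w) (X t w).
  have := ler_distD (X (e j) w) (X (e i) w) (X t w).
  rewrite (distrC (X s w) (X (e i) w)); lra.
apply: le_trans Pcap _.
apply: le_trans (_ : P ((\bigcap_m E m `\` N) `|` N) <= _)%E.
  apply: le_measure; rewrite ?inE//.
    by apply: measurableU => //; exact: measurableD.
  by move=> w Ew; have [Nw|Nw] := pselect (N w); [right|left].
apply: le_trans (measureU2 _ _ _) _ => //; first exact: measurableD.
by apply: le_trans (leeD (lexx _) PN) _; rewrite adde0.
Qed.

Theorem theorem4 (R : realType) :
  exists2 K0 : R, 0 < K0 &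
  forall alpha C2 : R, 0 < alpha -> alpha < 2 -> 1 < C2 -> C2 < 2 `^ alpha ->
  exists2 K : R, 0 < K &
  forall (d : measure_display) (Omega : measurableType d)
         (P : probability Omega R) (T : Type) (X : T -> {RV P >-> R})
         (rho : T -> T -> R) (Psi : R -> R),
    (exists t0 : T, True) ->
    SaS_process alpha X ->
    separable_process rho X ->
    (forall s t, 0 <= rho s t) ->
    (forall s t (u : R),
        ('E_P[fun w => cos (u * (X t w - X s w))]
           = (expR (- (rho t s `^ alpha * `|u| `^ alpha)))%:E)%E /\
        ('E_P[fun w => sin (u * (X t w - X s w))] = 0)%E) ->
    diam_finite rho ->
    totally_bounded rho ->
    (forall e, 0 < e -> (covering_number rho e <= (Psi e)%:E)%E) ->
    {in `]0, +oo[ &, {homo Psi : x y /~ x <= y}} ->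
    {in `]0, +oo[, continuous Psi} ->
    (forall e, 0 < e -> Psi (e / 2) <= C2 * Psi e) ->
    forall e : R, 0 < e ->
      exists2 A : set Omega, measurable A &
        A `<=` [set w | forall s t, `|X s w - X t w| <= K0 * e] /\
        ((expR (- (K * Psi_tilde Psi (diam rho) e)))%:E <= P A)%E.
Proof.
(* Two points within 4 e of a common base value differ by at most 8 e. *)
exists 8 => // alpha C2 alpha0 alpha2 C21 C2alpha.
have alpha02 : 0 < alpha < 2 by rewrite alpha0.
have [D D0 small_ball] := SaS_small_ball alpha alpha02.
have C20 : 0 < C2 by lra.
pose b := C2 `^ alpha^-1.
have b0 : 0 < b by exact: powR_gt0.
have ba : b `^ alpha = C2 by rewrite -powRrM mulVf ?gt_eqF// powRr1// ltW.
have b2 : b < 2.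
  rewrite ltNge; apply/negP => b2; have : 2 `^ alpha <= b `^ alpha.
    by apply: ge0_ler_powR; rewrite ?nnegrE ?(ltW alpha0) ?(ltW b0).
  by rewrite ba leNgt C2alpha.
(* The midpoint of b/2 and 1. Since C2 < 2^alpha means b < 2, both q < 1 and b < 2q hold, so th = (b
   / (2q))^alpha < 1. *)
pose q := (b / 2 + 1) / 2.
have q01 : 0 < q < 1 by rewrite /q; apply/andP; split; lra.
have q0 : 0 < 2 * q by rewrite /q; lra.
have q10 : 0 < 1 - q by rewrite /q; lra.
set th := C2 * (2 * q)^-1 `^ alpha.
have th1 : th < 1.
  have e1 : 1 `^ alpha = 1 :> R by rewrite powR1.
  rewrite /th -ba -powRM ?invr_ge0 ?(ltW b0) ?(ltW q0)// -[ltRHS]e1.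
  apply: gt0_ltr_powR; rewrite ?nnegrE ?divr_ge0 ?(ltW b0) ?(ltW q0)//.
  by rewrite ltr_pdivrMr// /q; lra.
pose K1 := coarse_constant alpha D + D * C2 * (1 - q)^-1 `^ alpha / (1 - th) + 1.
have K10 : 0 < K1.
  rewrite /K1 ltr_wpDl// addr_ge0 ?(ltW (coarse_constant_gt0 _ _ alpha0 D0))//.
  by rewrite divr_ge0 ?mulr_ge0 ?powR_ge0 ?(ltW D0) ?(ltW C20)//; lra.
(* [K1] comes from [finite_chain], the other factor from comparing the dyadic sum with
   [Psi_tilde]. *)
exists (K1 * (4 * C2 + 1)); first by rewrite mulr_gt0//; lra.
move=> d Omega P T X rho Psi [t0 _] sasX sepX rho0 charX diamX tb covX noninc cont dbl e e0.
have {}charX s t u := (charX s t u).1.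
have nets r : 0 < r -> exists (n : nat) (f : 'I_n -> T),
    n%:R <= Psi r /\ forall t, exists i, rho t (f i) <= r.
  by move=> r0; apply: covering_number_attained => //; exact: covX.
have Psi1 r : 0 < r -> 1 <= Psi r.
  move=> r0; have [n [f [nPsi fnet]]] := nets _ r0.
  have [i _] := fnet t0; apply: le_trans nPsi.
  by rewrite ler1n (leq_ltn_trans _ (ltn_ord i)).
have [J diamJ sumJ] :=
  sum_le_Psi_tilde Psi C2 C20 Psi1 noninc cont dbl (diam rho) e e0.
have sym := SaS_scale_sym P alpha T X rho alpha0 rho0 charX.
have quasi := SaS_scale_quasi_triangle P alpha T X rho alpha02 sasX charX.
apply: (separable_small_oscillation P T t0 X rho) => // f m.
have [|L [x0 [Lpos Lcost Lsat]]] :=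
    finite_chain rho alpha D alpha0 D0 rho0 sym quasi Psi nets e q C2 J m f e0 q01 C20 th1 dbl.
  by move=> s t; apply: le_trans diamJ; apply: ub_le_sup => //; exists s, t.
have [mE PE] := small_ball d Omega P T X rho L sasX rho0 charX Lpos.
exists [set w | satisfies (fun t => X t w) L]; split => //.
- rewrite -[leRHS]fineK ?fin_num_measure// lee_fin.
  apply: le_trans PE; rewrite ler_expR lerN2 -mulrA.
  by apply: le_trans Lcost _; rewrite ler_wpM2l// ltW.
- move=> w Ew i j im jm.
  have := Lsat _ Ew _ im; have := Lsat _ Ew _ jm.
  have := ler_distD (X x0 w) (X (f i) w) (X (f j) w).
  rewrite (distrC (X x0 w)); lra.
Qed.
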